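(* The set $\mathcal{O}_{RP}$ of regular origami numbers and the set $\mathcal{O}_{CP}$ of cyclic origami numbers satisfy $\mathcal{O}_{RP}\subset\mathcal{O}_{CP}$, and this inclusion is strict.
   Context: Constructions. Identify $\mathbb{C}$ with the Euclidean plane. A construction starts with the points $0,1$ (given) and proceeds by finitely many steps; each step adds a new constructed line or point obtained from previously constructed (''given'') ones by one of the axioms below. Folding along a line $f$ means applying the reflection across $f$; ''folding $f$ places a point $p$ onto a line $\ell$'' means that the reflection of $p$ across $f$ lies on $\ell$. Huzita-Justin axioms (HJAs): (O1) we can fold the line connecting two given distinct points; (O2) we can fold the perpendicular bisector of two given distinct points; (O3) we can fold the bisector of the angle defined by two given lines (either bisector, for intersecting lines); (O4) we can fold, through a given point, the perpendicular to a given line; (O5) we can fold a line passing through a given point that places another given point onto a given line; (O6) we can fold a line that places simultaneously two given points onto two given lines, respectively; (O7) we can fold a line perpendicular to a given line that places a given point onto another given line; (LI) the intersection point of two given non-parallel lines is constructible. In O5, O6, O7 the axiom is applied only to inputs for which there are finitely many lines with the required property, and any of these lines may be constructed. Regular Polygon Axioms (RPAs): for each $n\ge 3$, ($\mathrm{RPA}_n$) given the vertices $A_1,\dots,A_{n+1}$ (in counterclockwise order) of a regular $(n+1)$-gon, we can fold the line containing any side of the regular $n$-gon with vertices $B_1,\dots,B_n$ (in counterclockwise order) determined by $B_1=A_1$ and $B_2=A_2$. Cyclic polygons. A cyclic polygon is a polygon whose vertices lie on a circle; the radius and center of that circle are its circumradius and circumcenter. It is central if its circumcenter belongs to its interior.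 For positive reals $a_1,\dots,a_n$ ($n\ge3$) with $2\max_i a_i<\sum_i a_i$ there is, up to congruence, a unique convex cyclic polygon with side lengths $a_1,\dots,a_n$ in that order. For points $A_1,A_2$ with $|A_2-A_1|=a_1$, $Cy(a_1,\dots,a_n;A_1,A_2)$ denotes the convex cyclic polygon with side lengths $a_1,\dots,a_n$ in counterclockwise order whose first side has (consecutive, counterclockwise) vertices $A_1,A_2$. Cyclic Polygon Axioms (CPAs): for each $n\ge3$ and $k\in\{1,2\}$, ($\mathrm{CPA}_{n,k}$) given the vertices $A_1,\dots,A_{n+k}$ of a central cyclic polygon $P_1=Cy(a_1,\dots,a_{n+k};A_1,A_2)$, we can fold the line containing any side of $P_2=Cy(a_1,\dots,a_n;A_1,A_2)$, provided (1) the circumradius of $P_1$ is greater than that of $P_2$, and (2) $2\max_{1\le i\le n}a_i<\sum_{i=1}^n a_i$. A number $\alpha\in\mathbb{C}$ is a regular origami number (respectively, a cyclic origami number) if there is a finite sequence of applications of the HJAs and the RPAs (respectively, of the HJAs and the CPAs) that starts with $\{0,1\}$ and ends in the point $\alpha$. $\mathcal{O}_{RP}$ and $\mathcal{O}_{CP}$ denote the sets of all regular, respectively cyclic, origami numbers. *)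

(* Defs.v *)
From HB Require Import structures.
From mathcomp Require Import all_boot all_order all_algebra.
From mathcomp Require Import complex.
From mathcomp Require Import all_classical all_reals all_analysis.

Set Implicit Arguments.
Unset Strict Implicit.
Unset Printing Implicit Defensive.

Import Order.TTheory GRing.Theory Num.Theory.

Local Open Scope classical_set_scope.
Local Open Scope ring_scope.
Local Open Scope complex_scope.

Section Plane.
Context {R : realType}.
Local Notation C := R[i].
Implicit Types (a b c p q u v w z : C) (f l m : set C).

(* Euclidean inner product and signed area of two plane vectors:
   [0 < cross u v] says that v points strictly to the left of u. *)
Definition dot u v : R := complex.Re (u^* * v).
Definition cross u v : R := complex.Im (u^* * v).

Definition cis (t : R) : C := cos t +i* sin t.

(* A genuine line only when a != b. *)
Definition line a b : set C := [set z | exists t : R, z = a + t%:C * (b - a)].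

Definition parallel l m : Prop :=
  exists p q u, [/\ u != 0, l = line p (p + u) & m = line q (q + u)].

Definition perpendicular l m : Prop :=
  exists p u q v, [/\ u != 0, v != 0, l = line p (p + u), m = line q (q + v)
    & dot u v = 0].

Definition perp_bisector p q : set C := [set z | `|z - p| = `|z - q|].

(* For lines meeting at p, the diagonal of the rhombus spanned by direction
   vectors u, v of equal length; replacing v by -v gives the other bisector.
   For parallel lines, the line halfway between them. *)
Variant angle_bisector l m : set C -> Prop :=
| BisectorMeet p u v of u != 0 & `|u| = `|v|
    & l = line p (p + u) & m = line p (p + v) :
    angle_bisector l m (line p (p + (u + v)))
| BisectorParallel p q u of u != 0
    & l = line p (p + u) & m = line q (q + u) :
    angle_bisector l m (line ((p + q) / 2%:R) ((p + q) / 2%:R + u)).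

(* Reflection across the line through a and b (a != b). *)
Definition reflection a b z : C := a + (b - a) * ((z - a) / (b - a))^*.

(* f is a line, and folding along f places p onto l. *)
Definition places f p l : Prop :=
  exists a b, [/\ a != b, f = line a b & l (reflection a b p)].

(* Polygons are sequences of vertices; [next_vertex A i] is the vertex that
   follows A`_i cyclically, so the i-th side joins A`_i to it. *)
Definition next_vertex (A : seq C) (i : nat) : C := A`_(i.+1 %% size A).
Definition side_line (A : seq C) (i : nat) : set C :=
  line A`_i (next_vertex A i).

Definition regular_ngon (n : nat) (A : seq C) : Prop :=
  size A = n /\ exists c w, w != 0 /\
    forall j, (j < n)%N -> A`_j = c + w * cis (2 * pi * j%:R / n%:R).

(* The vertices are listed counterclockwise around a convex polygon: all the
   other vertices lie strictly to the left of each side. *)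
Definition convex_ccw (A : seq C) : Prop :=
  forall i j, (i < size A)%N -> (j < size A)%N ->
    j != i -> j != (i.+1 %% size A)%N ->
    0 < cross (next_vertex A i - A`_i) (A`_j - A`_i).

(* The interior of a polygon satisfying [convex_ccw], as an intersection of
   open half-planes. *)
Definition interior_ccw (A : seq C) : set C :=
  [set z | forall i, (i < size A)%N ->
    0 < cross (next_vertex A i - A`_i) (z - A`_i)].

Definition on_circle c (r : R) (A : seq C) : Prop :=
  forall z, z \in A -> `|z - c| = r%:C.

Definition has_sides (a : seq R) (A : seq C) : Prop :=
  size A = size a /\
  forall i, (i < size a)%N -> `|next_vertex A i - A`_i| = (a`_i)%:C.

(* P = Cy(a; A1, A2), with circumcenter c and circumradius r. *)
Definition Cy (a : seq R) (A1 A2 : C) (P : seq C) (c : C) (r : R) : Prop :=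
  [/\ (3 <= size a)%N /\ (forall x, x \in a -> 0 < x),
      has_sides a P, P`_0 = A1 /\ P`_1 = A2, convex_ccw P & on_circle c r P].

Definition polygon_ineq (a : seq R) : Prop :=
  2 * \big[Num.max/0]_(x <- a) x < \sum_(x <- a) x.

End Plane.

Section Constructions.
Context {R : realType}.
Local Notation C := R[i].

Inductive object : Type := Point of C | Line of set C.

(* An axiom system tells which objects can be added to the given ones. *)
Definition axioms := set object -> object -> Prop.

Inductive construction (ax : axioms) : set object -> Prop :=
| Start : construction ax [set Point 0; Point 1]
| Step G o : construction ax G -> ax G o -> construction ax (o |` G).

Definition constructible (ax : axioms) : set C :=
  [set z | exists2 G, construction ax G & G (Point z)].

Definition O5_folds (p q : C) (l : set C) : set (set C) :=
  [set f | f p /\ places f q l].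
Definition O6_folds (p q : C) (l m : set C) : set (set C) :=
  [set f | places f p l /\ places f q m].
Definition O7_folds (p : C) (l m : set C) : set (set C) :=
  [set f | perpendicular f m /\ places f p l].

Variant HJA (G : set object) : object -> Prop :=
| O1 p q of G (Point p) & G (Point q) & p != q : HJA G (Line (line p q))
| O2 p q of G (Point p) & G (Point q) & p != q : HJA G (Line (perp_bisector p q))
| O3 l m f of G (Line l) & G (Line m) & l <> m & angle_bisector l m f :
    HJA G (Line f)
| O4 p l f of G (Point p) & G (Line l) & perpendicular f l & f p :
    HJA G (Line f)
| O5 p q l f of G (Point p) & G (Point q) & G (Line l)
    & finite_set (O5_folds p q l) & O5_folds p q l f : HJA G (Line f)
| O6 p q l m f of G (Point p) & G (Point q) & G (Line l) & G (Line m)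
    & finite_set (O6_folds p q l m) & O6_folds p q l m f : HJA G (Line f)
| O7 p l m f of G (Point p) & G (Line l) & G (Line m)
    & finite_set (O7_folds p l m) & O7_folds p l m f : HJA G (Line f)
| LI l m z of G (Line l) & G (Line m) & ~ parallel l m & l z & m z :
    HJA G (Point z).

Variant RPA (n : nat) (G : set object) : object -> Prop :=
| RPA_fold (A B : seq C) i of
    (forall z, z \in A -> G (Point z))
    & regular_ngon n.+1 A & regular_ngon n B & B`_0 = A`_0 & B`_1 = A`_1
    & (i < n)%N : RPA n G (Line (side_line B i)).

Variant CPA (n k : nat) (G : set object) : object -> Prop :=
| CPA_fold (a : seq R) (P1 P2 : seq C) c1 r1 c2 r2 i of
    (forall z, z \in P1 -> G (Point z))
    & size a = (n + k)%N
    & Cy a P1`_0 P1`_1 P1 c1 r1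
    & interior_ccw P1 c1
    & Cy (take n a) P1`_0 P1`_1 P2 c2 r2
    & r2 < r1
    & polygon_ineq (take n a)
    & (i < n)%N : CPA n k G (Line (side_line P2 i)).

Definition regular_axioms : axioms :=
  fun G o => HJA G o \/ exists2 n, (3 <= n)%N & RPA n G o.

Definition cyclic_axioms : axioms :=
  fun G o => HJA G o \/
    exists n k, [/\ (3 <= n)%N, k = 1%N \/ k = 2%N & CPA n k G o].

End Constructions.

Definition O_RP (R : realType) : set R[i] := constructible regular_axioms.
Definition O_CP (R : realType) : set R[i] := constructible cyclic_axioms.
Arguments O_RP R : clear implicits.
Arguments O_CP R : clear implicits.

(* Main.v *)
(* Every object of a regular origami construction has coordinates in the field
   generated by all roots of unity and closed under roots of polynomials of
   degree at most 3: writing a fold as the fixed line of [z |-> u z^* + s], the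
   conditions of O5-O7 eliminate [s] and leave an equation of degree at most 3
   for [u], and a regular polygon only involves roots of unity. An irreducible
   rational quintic with exactly one real root has no root in this field. It
   stays irreducible over a cyclotomic field [E]: otherwise, [E] being Galois
   over Q, the quintic splits in [E]; since complex conjugation is central in
   the abelian Galois group, its roots would then be all real. It remains
   irreducible under extensions of degree 2 and 3, which are prime to 5.

   A regular (n+1)-gon and the n-gon on the same side are an instance of
   CPA_{n,1}, whence the inclusion. For strictness, let a heptagon have six
   equal sides a and a seventh side b = (20/7) a. If 2 alpha is the central angle
   of a, then sin(6 alpha) = (20/7) sin(alpha), so y = 2 cos(alpha) is a root of
   y^5 - 4 y^3 + 3 y = 20/7, which has one real root and is irreducible by
   Eisenstein's criterion at 7. CPA_{7,1} folds this heptagon from an octagon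
   with rational vertices on the unit circle. *)
From HB Require Import structures.
Require Import Defs.
From mathcomp Require Import all_boot all_order all_algebra all_fingroup.
From mathcomp Require Import complex.
From mathcomp Require Import all_classical all_reals all_analysis.
From mathcomp Require Import qpoly cyclic falgebra fieldext separable galois.
From mathcomp Require Import cyclotomic algnum.
From mathcomp Require Import ring lra.
Set Implicit Arguments. Unset Strict Implicit. Unset Printing Implicit Defensive.
Import Order.TTheory GRing.Theory Num.Theory.
Local Open Scope classical_set_scope.
Local Open Scope group_scope.
Local Open Scope complex_scope.
Local Open Scope ring_scope.

(** * Irreducibility under field extensions *)

Lemma irreducible_divisor (F : fieldType) (p : {poly F}) :
  (1 < size p)%N -> exists2 h : {poly F}, irreducible_poly h & h %| p.
Proof.
have [n] := ubnP (size p); elim: n p => // n IHn p le_pn p_gt1.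
case: (pselect (irreducible_poly p)) => [irr_p | nirr_p].
  by exists p.
have [q qp sq]: exists2 q, q %| p & (1 < size q < size p)%N.
  apply: contrapT => nq; apply: nirr_p; split=> // q q1 qp.
  have p0 : p != 0 by rewrite -size_poly_gt0 ltnW.
  have q0 : q != 0 by apply: contraNneq p0 => q0; rewrite -dvd0p -q0.
  rewrite -dvdp_size_eqp // eqn_leq dvdp_leq //= leqNgt.
  apply/negP=> lt_qp.
  by apply: nq; exists q => //; rewrite lt_qp ltn_neqAle eq_sym q1 size_poly_gt0 q0.
have /andP[q1 ltqp] := sq.
have [h irr_h hq] := IHn q (leq_trans ltqp le_pn) q1.
by exists h => //; apply: dvdp_trans qp.
Qed.

(** The minimal polynomial of [z] over [F] divides [p], hence has the degree of [p]. This degree is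
    the dimension of [<<1; z>>], and the tower law concludes. *)
Lemma irreducible_dim (F : fieldType) (L : fieldExtType F) (p : {poly F}) z :
  irreducible_poly p -> root (map_poly (in_alg L) p) z ->
  ((size p).-1 %| \dim {:L})%N.
Proof.
move=> irr_p pz.
have [m Dm] := polyOver1P (minPolyOver 1%AS z).
have mp : m %| p.
  rewrite -(dvdp_map (in_alg L)) -Dm minPoly_dvdp //.
  by apply/polyOver1P; exists p.
have sm : size m = (adjoin_degree 1%AS z).+1.
  by rewrite -size_minPoly Dm size_map_poly.
have m1 : size m != 1 by rewrite sm.
have := irr_p.2 m m1 mp; move/eqp_size <-; rewrite sm /=.
have := dim_Fadjoin 1%AS z; rewrite dimv1 muln1 => <-.
exact/field_dimS/subvf.
Qed.

(* With [h] an irreducible factor over [E] and [M = E[X]/(h)], the degree of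
   [p] divides [\dim_F M = (deg h) * \dim_F E], hence it divides [deg h]. *)
Lemma irreducible_coprime_ext (F : fieldType) (E : fieldExtType F)
    (p : {poly F}) :
  irreducible_poly p -> coprime (size p).-1 (\dim {:E}) ->
  irreducible_poly (map_poly (in_alg E) p).
Proof.
move=> irr_p cop; set q := map_poly _ p.
have p0 := irredp_neq0 irr_p.
have sq : size q = size p by rewrite size_map_poly.
have [h irr_h hq] : exists2 h, irreducible_poly h & h %| q.
  by apply: irreducible_divisor; rewrite sq; case: irr_p.
have [M dimM [z hz _]] := irredp_FAdjoin irr_h.
have pz : root (map_poly (in_alg (baseFieldType M)) p) z.
  have /dvdpP[k Dq] := hq.
  suff -> : map_poly (in_alg (baseFieldType M)) p = map_poly (in_alg M) q.
    by rewrite Dq rmorphM rootM hz orbT.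
  rewrite -map_poly_comp; apply: eq_map_poly => x /=.
  by rewrite baseField_scaleE.
have := irreducible_dim irr_p pz.
have -> : \dim {: baseFieldType M} = ((size h).-1 * \dim {:E})%N.
  rewrite -dimM -dim_baseVspace; congr (\dim _); apply/vspaceP => x.
  by rewrite mem_baseVspace (memvf (x : M)); apply: memvf.
rewrite Gauss_dvdl // => dv.
have h1 := irr_h.1; have p1 := irr_p.1.
have le_ph : (size p <= size h)%N.
  have h10 : (0 < (size h).-1)%N by rewrite -ltnS prednK // ltnW.
  by have := dvdn_leq h10 dv; rewrite -ltnS !prednK // ltnW.
have eq_hq : h %= q.
  rewrite -dvdp_size_eqp // eqn_leq dvdp_leq ?sq //.
  by rewrite -size_poly_gt0 sq ltnW.
split=> [|d d1 dq]; first by rewrite sq.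
have dh : d %| h by rewrite (eqp_dvdr _ eq_hq).
exact: eqp_trans (irr_h.2 d d1 dh) eq_hq.
Qed.

(** Peel off one factor [h] at a time: either it is prime to [p], and [p] divides the remaining
    product, or it is cancelled and the degree of [p] drops by [d]. *)
Lemma dvdp_irreducible_prod (F : fieldType) (d : nat) (hs : seq {poly F})
    (p : {poly F}) :
  (forall h, h \in hs -> irreducible_poly h /\ (size h).-1 = d) ->
  p %| \prod_(h <- hs) h -> (d %| (size p).-1)%N.
Proof.
elim: hs p => [|h hs IHhs] p hsP.
  by rewrite big_nil dvdp1 => /eqP ->.
have [irr_h sh] : irreducible_poly h /\ (size h).-1 = d.
  by apply: hsP; rewrite mem_head.
have {}IHhs q : q %| \prod_(h <- hs) h -> (d %| (size q).-1)%N.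
  by apply: IHhs => k hk; apply: hsP; rewrite inE hk orbT.
rewrite big_cons => dv.
have [hp | nhp] := boolP (h %| p); last first.
  apply: IHhs; move: dv; rewrite Gauss_dvdpr // coprimep_sym.
  by rewrite irreducible_poly_coprime.
have h0 := irredp_neq0 irr_h.
have [k Dp] := dvdpP _ _ hp; move: dv; rewrite Dp mulrC dvdp_mul2l //.
have [-> _ | k0 kd] := eqVneq k 0; first by rewrite mulr0 size_poly0.
rewrite size_mul // -[size h]prednK ?size_poly_gt0 //.
rewrite -[size k]prednK ?size_poly_gt0 // addSn addnS /= sh.
by rewrite dvdn_addr // IHhs.
Qed.

(* The product of the conjugates of an irreducible factor [h] of [p] has its
   coefficients in [F], so [p] divides it and is a product of conjugates of [h],
   all of the same degree. *)
Lemma irreducible_galois_ext (F : fieldType) (L : splittingFieldType F)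
    (p : {poly F}) :
  galois 1 {:L} -> irreducible_poly p -> prime (size p).-1 ->
  irreducible_poly (map_poly (in_alg L) p) \/
  exists r, root (map_poly (in_alg L) p) r.
Proof.
move=> galL irr_p pr_p; set q := map_poly _ p.
have sq : size q = size p by rewrite size_map_poly.
have q0 : q != 0 by rewrite -size_poly_gt0 sq ltnW //; case: irr_p.
have [h irr_h hq] : exists2 h, irreducible_poly h & h %| q.
  by apply: irreducible_divisor; rewrite sq; case: irr_p.
have h1 := irr_h.1.
have h0 := irredp_neq0 irr_h.
pose conj (s : gal_of {:L}) : {poly L} := map_poly s h.
pose H := \prod_(s in 'Gal({:L} / 1%AS)) conj s.
have [m Dm] : exists m, H = map_poly (in_alg L) m.
  apply/polyOver1P/polyOverP => i.
  have /galois_fixedField <- := galL.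
  apply/fixedFieldP => [|t galt]; first exact: memvf.
  rewrite -coef_map rmorph_prod /=; congr (_ : {poly _})`_i.
  rewrite [RHS](reindex_inj (mulIg t)) /=.
  apply: eq_big => [s|s gals]; first by rewrite groupMr.
  rewrite /conj -map_poly_comp; apply: eq_map_poly => x /=.
  by rewrite galM ?memvf.
have sconj s : size (conj s) = size h by rewrite size_map_poly.
have irr_conj s : irreducible_poly (conj s).
  split=> [|k k1 kh]; first by rewrite sconj.
  have invK : cancel (s^-1)%g s.
    by move=> x; rewrite -galM ?memvf // mulVg gal_id.
  have sK : cancel s (s^-1)%g.
    by move=> x; rewrite -galM ?memvf // mulgV gal_id.
  have Dk : k = map_poly s (map_poly (s^-1)%g k).
    by rewrite -map_poly_comp map_poly_id // => x _ /=; rewrite invK.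
  move: k1 kh; rewrite Dk /conj dvdp_map size_map_poly => k1 kh.
  by rewrite eqp_map; apply: irr_h.2.
have qH : q %| H.
  rewrite Dm dvdp_map; move: (irreducible_poly_coprime m irr_p).
  have [//|_] := boolP (p %| m); move=> /= cop.
  have : coprimep q H by rewrite Dm coprimep_map cop.
  rewrite coprimep_def => /eqP s1.
  have : h %| gcdp q H.
    rewrite dvdp_gcd hq /H (bigD1 1%g) ?group1 //= dvdp_mulr //.
    by rewrite /conj map_poly_id // => x _; rewrite gal_id.
  by move/dvdp_leq; rewrite -size_poly_gt0 s1 => /(_ isT); rewrite leqNgt h1.
have : ((size h).-1 %| (size q).-1)%N.
  apply: (@dvdp_irreducible_prod _ _ [seq conj s | s <- enum 'Gal({:L} / 1%AS)]).
    by move=> _ /mapP[s _ ->]; rewrite sconj.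
  by rewrite big_map big_enum.
rewrite sq => dv.
have /primeP[_ /(_ _ dv)/orP[/eqP sh|/eqP sh]] := pr_p.
  right; have sh2 : size h = 2 by rewrite -(prednK (ltnW h1)) sh.
  have [r hr] := poly2_root sh2.
  by exists r; have /dvdpP[k ->] := hq; rewrite rootM hr orbT.
left; have eq_hq : h %= q.
  rewrite -dvdp_size_eqp // sq -(prednK (ltnW h1)) sh prednK //.
  by rewrite ltnW //; case: irr_p.
split=> [|d d1 dq]; first by rewrite sq; case: irr_p.
have dh : d %| h by rewrite (eqp_dvdr _ eq_hq).
exact: eqp_trans (irr_h.2 d d1 dh) eq_hq.
Qed.

(** Take a nonzero polynomial of least size vanishing at [z]. The bound on its size later limits the
    degree of the extension generated by [z]. *)
Lemma minimal_polynomial (F K : fieldType) (iota : {rmorphism F -> K}) z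
    (p : {poly F}) :
  p != 0 -> root (map_poly iota p) z ->
  exists h : {poly F}, [/\ irreducible_poly h, root (map_poly iota h) z
    & (size h <= size p)%N].
Proof.
move=> p0 pz.
pose P n := `[< exists q : {poly F},
  [/\ q != 0, root (map_poly iota q) z & size q = n] >].
have exP : exists n, P n by exists (size p); apply/asboolP; exists p.
case: (ex_minnP exP) => n /asboolP[h [h0 hz sh]] min_n.
exists h; split=> //; last by rewrite sh; apply: min_n; apply/asboolP; exists p.
apply/(subfx_irreducibleP hz h0) => q qz q0.
by rewrite sh; apply: min_n; apply/asboolP; exists q.
Qed.

Lemma primitive_root_exists (C : numClosedFieldType) n :
  (0 < n)%N -> exists z : C, n.-primitive_root z.
Proof.
move=> n0; pose p : {poly C} := 'X^n - 1.
have [r Dp] := closed_field_poly_normal p.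
rewrite (monicP _) ?monicXnsubC // scale1r in Dp.
have rn1 : all n.-unity_root r by apply/allP=> z; rewrite -root_prod_XsubC -Dp.
have sz_r : (n < (size r).+1)%N by rewrite -(size_prod_XsubC r id) -Dp size_XnsubC.
have [|z] := hasP (has_prim_root n0 rn1 _ sz_r); last by exists z.
by rewrite -separable_prod_XsubC -Dp separable_Xn_sub_1 // pnatr_eq0 -lt0n.
Qed.

(** The field is the quotient of [Q[X]] by the minimal polynomial of a primitive root of [C], which
    yields the embedding [iota]. It is Galois because the powers of [w] split the separable
    polynomial [X^n - 1]. *)
Lemma cyclotomic_extension (C : numClosedFieldType) n : (0 < n)%N ->
  exists (L : splittingFieldType rat) (iota : {rmorphism L -> C}) (w : L),
    [/\ galois 1 {:L}, n.-primitive_root w & <<1; w>>%VS = fullv].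
Proof.
move=> n0; have [z prim_z] := primitive_root_exists C n0.
have p0 : 'X^n - 1 != 0 :> {poly rat} by rewrite -size_poly_gt0 size_XnsubC.
have [|h [irr_h hz _]] := @minimal_polynomial _ _ (@ratr C) z _ p0.
  by rewrite rmorphB /= map_polyXn rmorph1; apply/unity_rootP/prim_expr_order.
have h0 := irredp_neq0 irr_h.
pose L := SubFieldExtType hz irr_h.
pose iota : {rmorphism L -> C} := @subfx_inj _ _ (@ratr C) z h.
pose w : L := subfx_root _ z h.
have iw : iota w = z by apply: subfx_inj_root.
have prim_w : n.-primitive_root w by rewrite -(fmorph_primitive_root iota) iw.
have genL : <<1; w>>%VS = fullv.
  apply/vspaceP => x; rewrite memvf; apply/Fadjoin_polyP.
  have [q Dq] := subfxEroot hz h0 x.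
  by exists (map_poly (in_alg L) q) => //; apply/polyOver1P; exists q.
have Q_Xn1: ('X^n - 1 : {poly L}) \is a polyOver 1%AS.
  by rewrite rpredB ?rpred1 ?rpredX //= polyOverX.
have splitXn1: splittingFieldFor 1 ('X^n - 1) {:L}.
  pose r := codom (fun i : 'I_n => w ^+ i).
  have Dr: 'X^n - 1 = \prod_(y <- r) ('X - y%:P).
    by rewrite -(factor_Xn_sub_1 prim_w) big_mkord big_image.
  exists r; first by rewrite -Dr eqpxx.
  apply/eqP; rewrite eqEsubv subvf -genL; apply/FadjoinP; split.
    exact: subv_adjoin_seq.
  apply: seqv_sub_adjoin.
  rewrite -root_prod_XsubC -Dr rootE !hornerE /=.
  by rewrite (prim_expr_order prim_w) subrr.
have L_ax : FieldExt_isSplittingField _ L by constructor; exists ('X^n - 1).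
exists (HB.pack_for (splittingFieldType rat) L L_ax), iota, w; split=> //.
apply/splitting_galoisField; exists ('X^n - 1); split => //.
by rewrite separable_Xn_sub_1 // -(fmorph_eq0 iota) rmorph_nat pnatr_eq0 -lt0n.
Qed.

(* Complex conjugation commutes with the Galois group of the cyclotomic field,
   so the conjugates of a real element are real. *)
Lemma cyclotomic_galois_conj (C : numClosedFieldType) (conj : {rmorphism C -> C})
    (L : splittingFieldType rat) (iota : {rmorphism L -> C}) n (w : L)
    (s : gal_of {:L}) a :
  (0 < n)%N -> (forall z : C, z ^+ n = 1 -> conj z = z^-1) ->
  n.-primitive_root w -> <<1; w>>%VS = fullv ->
  conj (iota a) = iota a -> conj (iota (s a)) = iota (s a).
Proof.
move=> n0 conjV prim_w genL.
have [q -> {a}] : exists q : {poly rat}, a = (map_poly (in_alg L) q).[w].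
  have : a \in <<1; w>>%VS by rewrite genL memvf.
  by case/Fadjoin_polyP => _ /polyOver1P[q ->] ->; exists q.
have iotaE x : iota (map_poly (in_alg L) q).[x] = (map_poly ratr q).[iota x].
  rewrite -horner_map -map_poly_comp; congr _.[_].
  by apply: eq_map_poly => c; rewrite /= alg_num_field fmorph_rat.
have sE x : s (map_poly (in_alg L) q).[x] = (map_poly (in_alg L) q).[s x].
  rewrite -horner_map -map_poly_comp; congr _.[_].
  by apply: eq_map_poly => c; rewrite /= alg_num_field fmorph_rat.
have conjE x : conj (map_poly ratr q).[x] = (map_poly ratr q).[conj x].
  rewrite -horner_map -map_poly_comp; congr _.[_].
  by apply: eq_map_poly => c; rewrite /= fmorph_rat.
have wn := prim_expr_order prim_w.
have swn : s w ^+ n = 1 by rewrite -rmorphXn wn rmorph1.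
rewrite sE !iotaE !conjE !conjV -?rmorphXn ?wn ?swn ?rmorph1 //.
rewrite -!fmorphV -!iotaE => /fmorph_inj /(congr1 s).
by rewrite !sE => ->.
Qed.

(** If [p] had a root [r] in the cyclotomic field, [p] would split there into conjugates of [r], and
    [x] would be the image of one of them. All conjugates of this real element are real roots of
    [p], hence equal to it; so it is rational, against irreducibility in prime degree. *)
Lemma irreducible_cyclotomic (C : numClosedFieldType) (conj : {rmorphism C -> C})
    (p : {poly rat}) (x : C) n :
  (0 < n)%N -> (forall z : C, z ^+ n = 1 -> conj z = z^-1) ->
  irreducible_poly p -> prime (size p).-1 ->
  conj x = x -> root (map_poly ratr p) x ->
  (forall y, conj y = y -> root (map_poly ratr p) y -> y = x) ->
  exists (L : fieldExtType rat) (iota : {rmorphism L -> C}),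
    irreducible_poly (map_poly (in_alg L) p) /\
    forall z : C, z ^+ n = 1 -> exists a, z = iota a.
Proof.
move=> n0 conjV irr_p pr_p xR px xU.
have [L [iota [w [galL prim_w genL]]]] := cyclotomic_extension C n0.
exists L, iota; split; last first.
  have prim_iw : n.-primitive_root (iota w) by rewrite fmorph_primitive_root.
  move=> z /(prim_rootP prim_iw)[i ->].
  by exists (w ^+ i); rewrite rmorphXn.
case: (irreducible_galois_ext galL irr_p pr_p) => // -[r pr]; exfalso.
have iotaE q : map_poly iota (map_poly (in_alg L) q) = map_poly ratr q.
  rewrite -map_poly_comp; apply: eq_map_poly => c.
  by rewrite /= alg_num_field fmorph_rat.
have [m Dm] := polyOver1P (minPolyOver 1%AS r).
have mp : m %| p.
  rewrite -(dvdp_map (in_alg L)) -Dm minPoly_dvdp //.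
  by apply/polyOver1P; exists p.
have m1 : size m != 1.
  by have := size_minPoly 1%AS r; rewrite Dm size_map_poly => ->.
have mx : root (map_poly ratr m) x.
  by rewrite (eqp_root (_ : _ %= map_poly ratr p)) // eqp_map irr_p.2.
have /and3P[s1 _ norm1] := galL.
have [t tgal Dt] := normalField_factors s1 norm1 r (memvf r).
have : root (map_poly iota (minPoly 1 r)) x by rewrite Dm iotaE.
rewrite Dt rmorph_prod /= -(big_map (fun g : gal_of {:L} => g r) predT
  (fun b => map_poly iota ('X - b%:P))).
under eq_bigr do rewrite rmorphB /= map_polyX map_polyC /=.
rewrite -(big_map iota predT (fun b => 'X - b%:P)) root_prod_XsubC.
case/mapP => _ /mapP[g gt ->] Dx.
have gr1 : g r \in 1%VS.
  have /galois_fixedField <- := galL.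
  apply/fixedFieldP => [|s sgal]; first exact: memvf.
  apply: (fmorph_inj iota); rewrite -Dx; apply: xU.
    by apply: (cyclotomic_galois_conj s n0 conjV prim_w genL); rewrite -Dx.
  rewrite -(iotaE p) fmorph_root.
  have pg : root (map_poly (in_alg L) p) (g r).
    by rewrite -(fmorph_root iota) iotaE -Dx.
  rewrite -(fmorph_root s) -map_poly_comp in pg.
  rewrite (eq_map_poly (_ : s \o in_alg L =1 in_alg L)) // in pg.
  by move=> c; rewrite /= alg_num_field fmorph_rat.
have /vlineP[c Dc] := gr1.
have pc : root p c.
  rewrite -(fmorph_root (@ratr C)).
  by rewrite (_ : GRing.RMorphism.sort _ c = x) // Dx Dc alg_num_field fmorph_rat.
have /irr_p.2 : 'X - c%:P %| p by rewrite dvdp_XsubCl.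
rewrite size_XsubC => /(_ isT)/eqp_size; rewrite size_XsubC => sp.
by rewrite -sp in pr_p.
Qed.

(** * Numbers obtained from roots of unity and cubic equations *)

Lemma map_intr_poly (A B : nzRingType) (f : {rmorphism A -> B}) (p : {poly int}) :
  map_poly f (map_poly intr p) = map_poly intr p.
Proof.
by apply/polyP => i; rewrite !coef_map_id0 ?rmorph0 //= rmorph_int.
Qed.

Lemma size_intr_poly (C : numFieldType) (F : fieldType)
    (iota : {rmorphism F -> C}) (p : {poly int}) :
  size (map_poly intr p : {poly F}) = size p.
Proof.
rewrite -(size_map_poly iota) map_intr_poly.
have [-> | p0] := eqVneq p 0; first by rewrite rmorph0 !size_poly0.
by rewrite size_map_poly_id0 // intr_eq0 lead_coef_eq0.
Qed.

Section SolvableNumbers.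
Variable C : numClosedFieldType.

(** Sums come from differences, 0 being [1 - 1]. Size at most 4 means degree at most 3; the leading
    coefficients may vanish as long as the polynomial is not zero. *)
Inductive solvable_number : C -> Prop :=
| SolvableSub x y of solvable_number x & solvable_number y :
    solvable_number (x - y)
| SolvableMul x y of solvable_number x & solvable_number y :
    solvable_number (x * y)
| SolvableInv x of solvable_number x : solvable_number x^-1
| SolvableUnity z n of (0 < n)%N & z ^+ n = 1 : solvable_number z
| SolvableRoot (p : {poly C}) z of p != 0 & (size p <= 4)%N &
    (forall i, solvable_number p`_i) & root p z : solvable_number z.

Definition contains (F : fieldType) (iota : {rmorphism F -> C}) z :=
  exists a, z = iota a.

Variable p : {poly int}.
Hypothesis pr_p : prime (size p).-1.
Hypothesis p_gt3 : (3 < (size p).-1)%N.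

(** With integer coefficients, [p] can be read in every field of the tower without choosing
    embeddings. *)
Definition stays_irreducible (F : fieldType) :=
  irreducible_poly (map_poly intr p : {poly F}).

(* Allowing any multiple [m] of [n] makes it possible to fix a single cyclotomic
   base field for finitely many numbers. *)
Definition reachable (s : seq C) :=
  exists2 n, (0 < n)%N & forall m, (0 < m)%N -> (n %| m)%N ->
  forall (F : fieldType) (iota : {rmorphism F -> C}),
  stays_irreducible F -> (forall z, z ^+ m = 1 -> contains iota z) ->
  exists (E : fieldType) (j : {rmorphism E -> C}),
    [/\ stays_irreducible E, forall z, contains iota z -> contains j z
      & forall z, z \in s -> contains j z].

Lemma reachable_nil : reachable [::].
Proof. by exists 1 => // m _ _ F iota irrF _; exists F, iota. Qed.

(** Extend for [s], then for [t] over the field obtained, which still contains the roots of unity;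
    [n * k] is a multiple of both orders. *)
Lemma reachable_cat s t : reachable s -> reachable t -> reachable (s ++ t).
Proof.
case=> n n0 sP [k k0 tP]; exists (n * k)%N; first by rewrite muln_gt0 n0.
move=> m m0 dv F iota irrF unF.
have [|E [j [irrE FE sE]]] := sP m m0 _ F iota irrF unF.
  exact: dvdn_trans (dvdn_mulr _ _) dv.
have [|z zm|L [l [irrL EL tL]]] := tP m m0 _ E j irrE.
  exact: dvdn_trans (dvdn_mull _ _) dv.
  exact/FE/unF.
exists L, l; split=> // z; first by move/FE/EL.
by rewrite mem_cat => /orP[/sE/EL | /tL].
Qed.

Lemma reachable_seq (s : seq C) :
  (forall z, z \in s -> reachable [:: z]) -> reachable s.
Proof.
elim: s => [|x s IHs] sP; first exact: reachable_nil.
rewrite -cat1s; apply: reachable_cat; first by apply: sP; rewrite mem_head.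
by apply: IHs => z zs; apply: sP; rewrite inE zs orbT.
Qed.

Lemma reachable_sub s t :
  (forall (F : fieldType) (iota : {rmorphism F -> C}),
    (forall z, z \in s -> contains iota z) ->
    forall z, z \in t -> contains iota z) ->
  reachable s -> reachable t.
Proof.
move=> st [n n0 sP]; exists n => // m m0 dv F iota irrF unF.
have [E [j [irrE FE sE]]] := sP m m0 dv F iota irrF unF.
by exists E, j; split=> //; apply: st.
Qed.

(** The extension has degree at most 3, which is prime to the degree of [p], a prime greater than 3;
    so [irreducible_coprime_ext] applies. *)
Lemma adjoin_small_root (F : fieldType) (iota : {rmorphism F -> C})
    (q : {poly F}) z :
  stays_irreducible F -> q != 0 -> (size q <= 4)%N ->
  root (map_poly iota q) z ->
  exists (E : fieldType) (j : {rmorphism E -> C}),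
    [/\ stays_irreducible E, forall z, contains iota z -> contains j z
      & contains j z].
Proof.
move=> irrF q0 q4 qz; have [h [irr_h hz h_le]] := minimal_polynomial q0 qz.
have h0 := irredp_neq0 irr_h.
pose E := SubFieldExtType hz irr_h.
pose j : {rmorphism E -> C} := @subfx_inj _ _ iota z h.
exists E, j; split.
- rewrite /stays_irreducible.
  rewrite -(map_intr_poly (in_alg E)).
  apply: irreducible_coprime_ext; rewrite // (size_intr_poly iota).
  have -> : \dim {:E} = (size h).-1 by rewrite dimvf.
  rewrite prime_coprime // gtnNdvd //.
    by rewrite -ltnS prednK ?(ltnW irr_h.1) // irr_h.1.
  apply: leq_ltn_trans p_gt3.
  by rewrite -ltnS prednK ?(ltnW irr_h.1) ?(leq_trans h_le).
- by move=> _ [a ->]; exists (a%:A); rewrite [RHS]subfx_inj_base.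
- by exists (subfx_root _ z h); rewrite [RHS]subfx_inj_root.
Qed.

Lemma solvable_reachable z : solvable_number z -> reachable [:: z].
Proof.
elim=> {z} [x y _ xP _ yP|x y _ xP _ yP|x _ xP|z n n0 zn|q z q0 q4 _ qP qz].
- apply: reachable_sub (reachable_cat xP yP) => F iota sP z.
  rewrite inE => /eqP ->.
  have [|a ->] := sP x; first by rewrite mem_head.
  have [|b ->] := sP y; first by rewrite !inE eqxx orbT.
  by exists (a - b); rewrite rmorphB.
- apply: reachable_sub (reachable_cat xP yP) => F iota sP z.
  rewrite inE => /eqP ->.
  have [|a ->] := sP x; first by rewrite mem_head.
  have [|b ->] := sP y; first by rewrite !inE eqxx orbT.
  by exists (a * b); rewrite rmorphM.
- apply: reachable_sub xP => F iota sP z; rewrite inE => /eqP ->.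
  have [|a ->] := sP x; first by rewrite mem_head.
  by exists a^-1; rewrite fmorphV.
(* A root of unity requires no extension: the base field contains the [m]-th roots of unity, and [n]
   divides [m]. *)
- exists n => // m m0 /dvdnP[k Dm] F iota irrF unF; exists F, iota; split=> // y.
  by rewrite inE => /eqP ->; apply: unF; rewrite Dm mulnC exprM zn expr1n.
(* Adjoin the coefficients of [q] first; then [q] comes from the field [E], and its root [z] can be
   adjoined to [E]. *)
have [n n0 sP] : reachable q.
  by apply: reachable_seq => _ /(nthP 0)[i _ <-].
exists n => // m m0 dv F iota irrF unF.
have [E [j [irrE FE qE]]] := sP m m0 dv F iota irrF unF.
have /choice[a Da] i : contains j q`_i.
  have [lt_iq | ?] := ltnP i (size q); first by apply: qE; rewrite mem_nth.
  by exists 0; rewrite rmorph0 nth_default.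
have Dq : q = map_poly j (\poly_(i < size q) a i).
  apply/polyP => i; rewrite coef_map coef_poly.
  by case: ltnP => [_ | ?]; rewrite ?raddf0; [apply: Da | apply: nth_default].
have [|||L [l [irrL EL zL]]] := @adjoin_small_root E j (\poly_(i < size q) a i) z irrE.
- by rewrite -(map_poly_eq0 j) -Dq.
- by rewrite -(size_map_poly j) -Dq.
- by rewrite -Dq.
exists L, l; split=> // [y /FE/EL //|y].
by rewrite inE => /eqP ->.
Qed.

End SolvableNumbers.

Lemma irreducible_root_size (F : fieldType) (p : {poly F}) c :
  irreducible_poly p -> root p c -> size p = 2.
Proof.
move=> irr_p; rewrite -dvdp_XsubCl => /irr_p.2.
by rewrite size_XsubC => /(_ isT)/eqp_size <-; rewrite size_XsubC.
Qed.

(** Start from a cyclotomic field of the order that [x] requires, where [p] is still irreducible. It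
    stays irreducible up to a field containing [x], where having a root forces degree 1. *)
Lemma not_solvable_number (C : numClosedFieldType) (conj : {rmorphism C -> C})
    (p : {poly int}) (x : C) :
  (forall n (z : C), (0 < n)%N -> z ^+ n = 1 -> conj z = z^-1) ->
  irreducible_poly (map_poly intr p : {poly rat}) ->
  prime (size p).-1 -> (3 < (size p).-1)%N ->
  conj x = x -> root (map_poly intr p) x ->
  (forall y, conj y = y -> root (map_poly intr p) y -> y = x) ->
  ~ solvable_number x.
Proof.
move=> conjV irr_p pr_p p3 xR px xU /(solvable_reachable pr_p p3)[n n0 nP].
have sp := size_intr_poly (@ratr C) p.
have [|||L [iota [irrL unL]]] := @irreducible_cyclotomic C conj (map_poly intr p)
    x n n0 (fun z => conjV n z n0) irr_p _ xR.
- by rewrite sp.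
- by rewrite map_intr_poly.
- by rewrite map_intr_poly.
have [|E [j [irrE _ xE]]] := nP n n0 (dvdnn n) L iota _ unL.
  by rewrite /stays_irreducible -(map_intr_poly (in_alg L)).
have [|a Dx] := xE x; first by rewrite mem_head.
have pa : root (map_poly intr p) a.
  by rewrite -(fmorph_root j) map_intr_poly -Dx.
have := irreducible_root_size irrE pa.
by rewrite (size_intr_poly j) => sp2; rewrite sp2 in p3.
Qed.

(** * Regular origami numbers are solvable numbers *)

Section SolvableClosure.
Variable C : numClosedFieldType.
Implicit Types x y z : C.
Local Notation solv := (@solvable_number C).

Lemma solv1 : solv 1. Proof. exact: (@SolvableUnity _ _ 1). Qed.
Lemma solv0 : solv 0.
Proof. by rewrite -(subrr 1); apply: SolvableSub; apply: solv1. Qed.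
Lemma solvN x : solv x -> solv (- x).
Proof. by move=> sx; rewrite -sub0r; apply: SolvableSub => //; apply: solv0. Qed.
Lemma solvD x y : solv x -> solv y -> solv (x + y).
Proof. by move=> sx /solvN sy; rewrite -[y]opprK; apply: SolvableSub. Qed.
Lemma solv_div x y : solv x -> solv y -> solv (x / y).
Proof. by move=> sx sy; apply: SolvableMul => //; apply: SolvableInv. Qed.
Lemma solvX x n : solv x -> solv (x ^+ n).
Proof.
move=> sx; elim: n => [|n IHn]; first exact: solv1.
by rewrite exprS; apply: SolvableMul.
Qed.

Lemma solv_root3 a b c d z : solv a -> solv b -> solv c -> solv d ->
  [|| a != 0, b != 0, c != 0 | d != 0] ->
  a * z ^+ 3 + b * z ^+ 2 + c * z + d = 0 -> solv z.
Proof.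
move=> sa sb sc sd nz z0; pose p : {poly C} := Poly [:: d; c; b; a].
have pE i : p`_i = [:: d; c; b; a]`_i by rewrite coef_Poly.
apply: (@SolvableRoot _ p).
- apply: contraTneq nz => p0; rewrite !negb_or !negbK.
  by move: (pE 0) (pE 1) (pE 2) (pE 3); rewrite p0 !coef0 /= => <- <- <- <-; rewrite eqxx.
- exact: size_Poly.
- move=> i; rewrite pE.
  by case: i => [|[|[|[|i]]]] //=; rewrite nth_nil; apply: solv0.
by rewrite /root horner_Poly /=; apply/eqP; rewrite -[RHS]z0; ring.
Qed.

Lemma solv_root2 b c d z : solv b -> solv c -> solv d ->
  [|| b != 0, c != 0 | d != 0] -> b * z ^+ 2 + c * z + d = 0 -> solv z.
Proof.
move=> sb sc sd nz z0; apply: (solv_root3 solv0 sb sc sd); rewrite ?nz ?orbT //.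
by rewrite mul0r add0r.
Qed.

Lemma solv_rmorph (f : {rmorphism C -> C}) z : solv z -> solv (f z).
Proof.
elim=> {z} [x y _ fx _ fy|x y _ fx _ fy|x _ fx|z n n0 zn|q z q0 q4 _ qP qz].
- by rewrite rmorphB; apply: SolvableSub.
- by rewrite rmorphM; apply: SolvableMul.
- by rewrite fmorphV; apply: SolvableInv.
- by apply: (@SolvableUnity _ _ n); rewrite // -rmorphXn zn rmorph1.
apply: (@SolvableRoot _ (map_poly f q)).
- by rewrite map_poly_eq0.
- by rewrite size_map_poly.
- by move=> i; rewrite coef_map; apply: qP.
- by rewrite fmorph_root.
Qed.
End SolvableClosure.

Ltac fld := field; repeat (apply/andP; split); assumption.

(** * Lines as axes of reflections *)

Section Mirrors.
Context {R : realType}.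
Local Notation C := R[i].
Implicit Types (a b c d p q u s v w x y z : C) (f l m : set C).

Lemma conjD x y : (x + y)^* = x^* + y^* :> C. Proof. exact: rmorphD. Qed.
Lemma conjN x : (- x)^* = - x^* :> C. Proof. exact: rmorphN. Qed.
Lemma conjM x y : (x * y)^* = x^* * y^* :> C. Proof. exact: rmorphM. Qed.
Lemma conjV x : (x^-1)^* = (x^*)^-1 :> C. Proof. exact: fmorphV. Qed.
Lemma conjX x n : (x ^+ n)^* = x^* ^+ n :> C. Proof. exact: rmorphXn. Qed.
Lemma conjn n : (n%:R)^* = n%:R :> C. Proof. exact: rmorph_nat. Qed.
Lemma conjK x : x^*^* = x :> C. Proof. exact: conjCK. Qed.
Lemma conj_real (t : R) : t%:C^* = t%:C. Proof. exact: conjc_real. Qed.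
Lemma conj_eq0 x : (x^* == 0) = (x == 0) :> bool. Proof. exact: conjC_eq0. Qed.
Definition conjE := (conjD, conjN, conjM, conjV, conjX, conjn, conjK).

(* The fixed line of [z |-> a * z^* + b], which is a reflection when
   [is_mirror a b] holds. *)
Definition mirror a b : set C := [set z | z = a * z^* + b].
Lemma mirrorE a b z : mirror a b z = (z = a * z^* + b). Proof. by []. Qed.
(** The square of [z |-> a z^* + b] is [z |-> a a^* z + (a b^* + b)]; the two equations make it the
    identity. *)
Definition is_mirror a b := a * a^* = 1 /\ a * b^* + b = 0.

Lemma is_mirror_neq0 a b : is_mirror a b -> a != 0.
Proof.
by case=> a1 _; apply/eqP => a0; move: a1; rewrite a0 mul0r => /eqP; rewrite eq_sym oner_eq0.
Qed.

Lemma is_mirror_conj a b : is_mirror a b -> a^* = a^-1 /\ b^* = - b / a.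
Proof.
move=> ab; have a0 := is_mirror_neq0 ab; case: ab => a1 b0; split.
  by apply: (mulfI a0); rewrite a1 divff.
apply: (mulfI a0); rewrite mulrCA divff // mulr1.
by apply/eqP; rewrite -addr_eq0 b0.
Qed.

Lemma is_mirror_dir v p : v != 0 -> is_mirror (v / v^*) (p - v / v^* * p^*).
Proof.
move=> v0; have v'0 : v^* != 0 by rewrite conj_eq0.
split; rewrite !conjE.
  fld.
fld.
Qed.

(** A point [z] is on the line exactly when [(z - p) / v] is equal to its conjugate. *)
Lemma line_mirror p v : v != 0 ->
  line p (p + v) = mirror (v / v^*) (p - v / v^* * p^*).
Proof.
move=> v0; have v'0 : v^* != 0 by rewrite conj_eq0.
apply/seteqP; split => z.
  move=> [t ->]; rewrite mirrorE !conjE (conj_real t).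
  fld.
rewrite mirrorE => zE.
have tR : ((z - p) / v)^* = (z - p) / v.
  rewrite !conjE {2}zE; fld.
exists (complex.Re ((z - p) / v)).
have -> : (complex.Re ((z - p) / v))%:C = (z - p) / v.
  move: tR; case: (_ / v) => x y /= [] /eqP.
  by rewrite eq_sym -addr_eq0 -mulr2n mulrn_eq0 /= => /eqP ->.
fld.
Qed.

Lemma line_mirrorB p q : p != q ->
  line p q = mirror ((q - p) / (q - p)^*) (p - (q - p) / (q - p)^* * p^*).
Proof. by move=> pq; rewrite -line_mirror ?subr_eq0 1?eq_sym // addrC subrK. Qed.

Lemma mirror_dir a : a * a^* = 1 -> exists2 v, v != 0 & a = v / v^*.
Proof.
move=> a1; have a0 : a != 0.
  by apply/eqP => a0; move: a1; rewrite a0 mul0r => /eqP; rewrite eq_sym oner_eq0.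
(* The direction [1 + a] works, its conjugate being [(1 + a) / a]. It vanishes only for [a = -1],
   the case of vertical lines. *)
have [->|aN1] := eqVneq a (-1).
  exists 'i; first by rewrite eq_complex /= oner_eq0 andbF.
  rewrite (_ : 'i^* = - 'i); last by apply/eqP; rewrite eq_complex /= oppr0 !eqxx.
  by rewrite invrN mulrN divff // eq_complex /= oner_eq0 andbF.
exists (1 + a); first by rewrite addrC addr_eq0.
have -> : (1 + a)^* = (1 + a) / a.
  rewrite conjD (conjn 1) mulrDl divff // mul1r addrC.
  by congr (_ + 1); apply: (mulfI a0); rewrite a1 divff.
by rewrite invf_div mulrC divfK // addrC addr_eq0.
Qed.

Lemma mirror_line a b p v : is_mirror a b -> v != 0 -> a = v / v^* ->
  mirror a b p -> mirror a b = line p (p + v).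
Proof.
move=> ab v0 Da pab; rewrite line_mirror // -Da; congr (mirror _ _).
by rewrite {1}pab addrAC subrr add0r.
Qed.

(** [b] is the image of 0, so the midpoint of 0 and [b] lies on the axis. This supplies a point on
    any mirror. *)
Lemma mirror_half a b : is_mirror a b -> mirror a b (b / 2%:R).
Proof.
move=> ab; have [_ bE] := is_mirror_conj ab; have a0 := is_mirror_neq0 ab.
rewrite mirrorE !conjE bE; fld.
Qed.

Lemma mirror_inj a b c d : is_mirror a b -> is_mirror c d ->
  mirror a b = mirror c d -> a = c /\ b = d.
Proof.
move=> ab cd E; have [v v0 Da] := mirror_dir ab.1.
have v'0 : v^* != 0 by rewrite conj_eq0.
have pab := mirror_half ab; set p := b / _ in pab.
have Eab := mirror_line ab v0 Da pab.
have qab : mirror a b (p + v).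
  by rewrite Eab; exists 1; rewrite (_ : 1%:C = 1) //; ring.
have pcd := pab; have qcd := qab; rewrite E in pcd qcd.
have ac : a = c.
  apply: (mulIf v'0).
  have -> : a * v^* = v.
    by rewrite Da divfK.
  move: qcd pcd; rewrite mirrorE conjD => qcd pcd.
  by apply: (addrI p); rewrite {1}qcd {2}pcd; ring.
split=> //; move: pab pcd; rewrite mirrorE -ac => pab pcd.
by apply: (addrI (a * p^*)); rewrite -pab.
Qed.

Lemma reflection_mirror x y z : x != y ->
  reflection x y z = (y - x) / (y - x)^* * z^* + (x - (y - x) / (y - x)^* * x^*).
Proof.
move=> xy; rewrite /reflection.
have v0 : y - x != 0 by rewrite subr_eq0 eq_sym.
have v'0 : (y - x)^* != 0 by rewrite conj_eq0.
move: (y - x) v0 v'0 => v v0 v'0.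
rewrite !conjE; fld.
Qed.

(** The image [u p^* + s] of [p] is substituted into the equation of the target line, with
    [u^* = 1/u] and [s^* = - s/u]. The result is linear in the offset [s], which makes its
    elimination possible. *)
Lemma placesP u s a b p : is_mirror u s -> is_mirror a b ->
  places (mirror u s) p (mirror a b) <->
  s * (u + a) = a * p + b * u - p^* * u ^+ 2.
Proof.
move=> us ab; have [uC sC] := is_mirror_conj us.
have u0 := is_mirror_neq0 us.
have -> : places (mirror u s) p (mirror a b) <-> mirror a b (u * p^* + s).
  split=> [[x [y [xy E]]]|H].
    rewrite reflection_mirror //.
    have [] := mirror_inj us (is_mirror_dir x (_ : y - x != 0)) _.
    - by rewrite subr_eq0 eq_sym.
    - by rewrite E line_mirrorB.
    by move=> <- <-.
  have [v v0 Du] := mirror_dir us.1.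
  have := mirror_half us; set q := s / _ => qus.
  exists q, (q + v); split.
  - by rewrite -subr_eq0 opprD addrA subrr sub0r oppr_eq0.
  - exact: mirror_line.
  rewrite reflection_mirror; last by rewrite -subr_eq0 opprD addrA subrr sub0r oppr_eq0.
  rewrite [q + v - q]addrC addKr -Du.
  have -> : q - u * q^* = s; last by [].
  by move: qus; rewrite mirrorE => {1}->; rewrite addrAC subrr add0r.
rewrite mirrorE !conjE uC sC.
split=> [E|E].
  have -> : s * (u + a) = u * (u * p^* + s) + s * a - p^* * u ^+ 2 by ring.
  by rewrite E; fld.
apply: (mulfI u0); rewrite mulrDr.
have -> : u * s = s * (u + a) - s * a by ring.
by rewrite E; fld.
Qed.

(** Solving [placesP] for [s] always gives a genuine fold, unless [u = - a], that is, unless the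
    fold is perpendicular to the target line. *)
Lemma fold_is_mirror a b u p : is_mirror a b -> u * u^* = 1 -> u + a != 0 ->
  is_mirror u ((a * p + b * u - p^* * u ^+ 2) / (u + a)).
Proof.
move=> ab u1 ua0; have [aC bC] := is_mirror_conj ab.
have a0 := is_mirror_neq0 ab.
have u0 : u != 0.
  by apply/eqP => u0; move: u1; rewrite u0 mul0r => /eqP; rewrite eq_sym oner_eq0.
have uC : u^* = u^-1 by apply: (mulfI u0); rewrite u1 divff.
split=> //; rewrite !conjE uC aC bC.
have au0 : a + u != 0 by rewrite addrC.
fld.
Qed.
End Mirrors.

(** * The fold axioms preserve solvable coordinates *)

Section MirrorFolds.
Context {R : realType}.
Local Notation C := R[i].
Implicit Types (a b c d p q u s v w x y z : C) (f l m : set C).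
Local Notation solv := (@solvable_number C).

Lemma sqr_norm x : `|x| ^+ 2 = x * x^* :> C. Proof. exact: normCK. Qed.

Lemma complex_i_neq0 : 'i%C != 0 :> C.
Proof. by rewrite eq_complex /= oner_eq0 andbF. Qed.

(** The finiteness conditions of O5, O6 and O7 are used through this lemma: a degenerate equation
    would produce infinitely many folds. *)
Lemma finite_mirrors (S : set (set C)) (u s : nat -> C) :
  finite_set S -> (forall n, is_mirror (u n) (s n)) ->
  (forall n, S (mirror (u n) (s n))) -> injective (fun n => (u n, s n)) -> False.
Proof.
move=> finS us Sus inj_us; pose g n := mirror (u n) (s n).
have inj_g : injective g.
  move=> n k; rewrite /g => E; have [uE sE] := mirror_inj (us n) (us k) E.
  by apply: inj_us; rewrite /= uE sE.
apply: infinite_nat; apply: (card_le_finite _ finS).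
apply: (@card_le_trans _ _ _ (g @` [set: nat])); last first.
  by apply: subset_card_le => _ [n _ <-]; apply: Sus.
by rewrite (card_le_eqr (inj_card_eq _)) // => n k _ _; apply: inj_g.
Qed.

(** Take [v / v^*] for the pairwise non-parallel directions [v = n + i]. If [b] is one of the
    values, the family starts just after it. *)
Lemma unit_family b : exists u : nat -> C,
  [/\ forall n, u n * (u n)^* = 1, injective u & forall n, u n != b].
Proof.
have i0 := complex_i_neq0; have iC : ('i%C : C)^* = - 'i%C.
  by apply/eqP; rewrite eq_complex /= oppr0 !eqxx.
pose v n : C := n%:R + 'i%C; pose u n := v n / (v n)^*.
have v0 n : v n != 0.
  apply/eqP => vn0; have : 2%:R * 'i%C = v n - (v n)^* by rewrite /v conjD conjn iC; ring.
  by rewrite vn0 conjC0 subrr => /eqP; rewrite mulf_eq0 (negPf i0) pnatr_eq0.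
have v'0 n : (v n)^* != 0 by rewrite conj_eq0.
have u1 n : u n * (u n)^* = 1.
  rewrite /u; move: (v n) (v0 n) (v'0 n) => w w0 w'0; rewrite !conjE; fld.
have uI : injective u.
  move=> n k E; have E2 : v n * (v k)^* = v k * (v n)^*.
    transitivity (u n * (v n)^* * (v k)^*); first by rewrite /u divfK.
    by rewrite E /u mulrAC divfK.
  have E3 : (2%:R * 'i%C) * (k%:R - n%:R) = 0 :> C.
    move: E2; rewrite /v !conjD !conjn iC => /eqP; rewrite -subr_eq0 => /eqP E2.
    by rewrite -[RHS]E2; ring.
  apply/eqP; rewrite eq_sym -(eqr_nat C) -subr_eq0.
  by move/eqP: E3; rewrite !mulf_eq0 (negPf i0) pnatr_eq0.
case: (pselect (exists n, u n = b)) => [[m um]|nu]; last first.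
  by exists u; split=> // n; apply/eqP => E; apply: nu; exists n.
exists (fun n => u (m.+1 + n)%N); split=> // [n k /uI /addnI //|n].
rewrite -um; apply/eqP => /uI/eqP.
by rewrite -{2}[m]addn0 addSnnS eqn_add2l.
Qed.

(** Infinitely many parallel mirrors: for [u = v / v^*], the condition on [s] holds for real
    multiples of [i v]. They serve when the fold is perpendicular to its target line and its offset
    is therefore unconstrained. *)
Lemma perpendicular_family u : u * u^* = 1 -> exists s : nat -> C,
  injective s /\ forall n, is_mirror u (s n).
Proof.
move=> u1; have [v v0 Du] := mirror_dir u1.
have v'0 : v^* != 0 by rewrite conj_eq0.
have i0 := complex_i_neq0; have iC : ('i%C : C)^* = - 'i%C.
  by apply/eqP; rewrite eq_complex /= oppr0 !eqxx.
exists (fun n => n%:R * ('i%C * v)); split => [n k|n].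
  have iv0 : 'i%C * v != 0 by rewrite mulf_neq0.
  by move/(mulIf iv0)/eqP; rewrite eqr_nat => /eqP.
by split=> //; rewrite !conjE iC Du; fld.
Qed.

Definition solvable_line l :=
  exists a b, [/\ solv a, solv b, is_mirror a b & l = mirror a b].

Lemma solv_conj z : solv z -> solv z^*.
Proof. exact: (solv_rmorph Num.conj). Qed.

Lemma solvable_lineP p v : solv p -> solv v -> v != 0 ->
  solvable_line (line p (p + v)).
Proof.
move=> sp sv v0; exists (v / v^*), (p - v / v^* * p^*).
have sa : solv (v / v^*) by apply: solv_div => //; apply: solv_conj.
split=> //; last exact: line_mirror.
  by apply: SolvableSub => //; apply: SolvableMul => //; apply: solv_conj.
exact: is_mirror_dir.
Qed.

Lemma solvable_line_points p q : solv p -> solv q -> p != q ->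
  solvable_line (line p q).
Proof.
move=> sp sq pq; have -> : q = p + (q - p) by rewrite addrC subrK.
by apply: solvable_lineP; rewrite ?subr_eq0 1?eq_sym //; apply: SolvableSub.
Qed.

Lemma places_line f p l : places f p l ->
  exists u s, is_mirror u s /\ f = mirror u s.
Proof.
move=> [x [y [xy -> _]]]; exists ((y - x) / (y - x)^*).
exists (x - (y - x) / (y - x)^* * x^*); split; last exact: line_mirrorB.
by apply: is_mirror_dir; rewrite subr_eq0 eq_sym.
Qed.

Lemma solv_fold_offset u s a b p : solv u -> solv a -> solv b -> solv p ->
  u + a != 0 -> s * (u + a) = a * p + b * u - p^* * u ^+ 2 -> solv s.
Proof.
move=> su sa sb sp ua E.
have -> : s = (a * p + b * u - p^* * u ^+ 2) / (u + a) by rewrite -E mulfK.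
apply: solv_div; last exact: solvD.
apply: SolvableSub; first by apply: solvD; apply: SolvableMul.
by apply: SolvableMul; [apply: solv_conj | apply: solvX].
Qed.

(* Eliminating the offset [s] of the fold between the two incidence conditions
   leaves a cubic equation for [u]. It is trivial only if every direction
   (except possibly one) gives a fold. *)
Lemma solvable_O6 p q l m f : solv p -> solv q -> solvable_line l ->
  solvable_line m -> finite_set (O6_folds p q l m) -> O6_folds p q l m f ->
  solvable_line f.
Proof.
move=> sp sq [a [b [sa sb ab ->]]] [c [d [sc sd cd ->]]] fin [fp fq].
have [u [s [us Df]]] := places_line fp; subst f.
have E1 := (placesP p us ab).1 fp; have E2 := (placesP q us cd).1 fq.
have sp' := solv_conj sp; have sq' := solv_conj sq.
have E3 : (q^* - p^*) * u ^+ 3 + (b - c * p^* - d + a * q^*) * u ^+ 2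
    + (a * p + b * c - c * q - d * a) * u + a * c * (p - q) = 0.
  have E : (a * p + b * u - p^* * u ^+ 2) * (u + c)
         = (c * q + d * u - q^* * u ^+ 2) * (u + a).
    by rewrite -E1 -E2 mulrAC.
  by move/eqP: E; rewrite -subr_eq0 => /eqP E; rewrite -[RHS]E; ring.
have su : solv u.
  have [nz|] := boolP [|| q^* - p^* != 0, b - c * p^* - d + a * q^* != 0,
      a * p + b * c - c * q - d * a != 0 | a * c * (p - q) != 0].
    apply: (solv_root3 _ _ _ _ nz E3).
    - exact: SolvableSub.
    - apply: solvD; last exact: SolvableMul.
      by apply: SolvableSub => //; apply: SolvableSub => //; apply: SolvableMul.
    - apply: SolvableSub; last exact: SolvableMul.
      apply: SolvableSub; last exact: SolvableMul.
      by apply: solvD; apply: SolvableMul.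
    - by apply: SolvableMul; [apply: SolvableMul | apply: SolvableSub].
  rewrite !negb_or !negbK => /and4P[/eqP k3 /eqP k2 /eqP k1 /eqP k0]; exfalso.
  have [w [w1 wI wa]] := unit_family (- a).
  have {}wa n : w n + a != 0 by rewrite addr_eq0.
  apply: (finite_mirrors fin (u := w)
    (s := fun n => (a * p + b * w n - p^* * w n ^+ 2) / (w n + a))).
  - by move=> n; apply: fold_is_mirror.
  - move=> n; have ws := fold_is_mirror p ab (w1 n) (wa n).
    split; apply/placesP => //; first by rewrite divfK.
    apply: (mulIf (wa n)); rewrite mulrAC divfK //.
    apply/eqP; rewrite -subr_eq0; apply/eqP.
    transitivity ((q^* - p^*) * w n ^+ 3 + (b - c * p^* - d + a * q^*) * w n ^+ 2
      + (a * p + b * c - c * q - d * a) * w n + a * c * (p - q)); first by ring.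
    by rewrite k3 k2 k1 k0 !mul0r !addr0.
  - by move=> n k [/wI].
exists u, s; split=> //.
(* Either condition determines [s] unless the fold is perpendicular to the corresponding target
   line. If it is perpendicular to both, every parallel line is a fold too, against finiteness. *)
have [ua|ua] := eqVneq (u + a) 0; last exact: (solv_fold_offset su sa sb sp ua E1).
have [uc|uc] := eqVneq (u + c) 0; last exact: (solv_fold_offset su sc sd sq uc E2).
exfalso; have [w [wI wu]] := perpendicular_family us.1.
apply: (finite_mirrors fin (u := fun=> u) (s := w)) => // [n|n k [/wI]] //.
rewrite ua mulr0 in E1; rewrite uc mulr0 in E2.
by split; apply/placesP => //; rewrite ?ua ?uc mulr0.
Qed.

(** Passing through [p] forces [s = p - u p^*], and the incidence condition becomes quadratic in
    [u]. If it were trivial, every line through [p] would be a fold. *)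
Lemma solvable_O5 p q l f : solv p -> solv q -> solvable_line l ->
  finite_set (O5_folds p q l) -> O5_folds p q l f -> solvable_line f.
Proof.
move=> sp sq [a [b [sa sb ab ->]]] fin [fp fq].
have [u [s [us Df]]] := places_line fq; subst f.
have E1 := (placesP q us ab).1 fq; move: fp; rewrite mirrorE => fp.
have sp' := solv_conj sp; have sq' := solv_conj sq.
have sE : s = p - u * p^* by rewrite {1}fp addrAC subrr add0r.
have E3 : (q^* - p^*) * u ^+ 2 + (p - a * p^* - b) * u + a * (p - q) = 0.
  apply/eqP; rewrite -[X in _ == X](subrr (s * (u + a))) {2}E1 sE.
  by apply/eqP; ring.
have su : solv u.
  have [nz|] := boolP [|| q^* - p^* != 0, p - a * p^* - b != 0 | a * (p - q) != 0].
    apply: (solv_root2 _ _ _ nz E3).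
    - exact: SolvableSub.
    - by apply: SolvableSub => //; apply: SolvableSub => //; apply: SolvableMul.
    - by apply: SolvableMul => //; apply: SolvableSub.
  rewrite !negb_or !negbK => /and3P[/eqP k2 /eqP k1 /eqP k0]; exfalso.
  have [w [w1 wI _]] := unit_family 0.
  have wp n : is_mirror (w n) (p - w n * p^*).
    split=> //; rewrite !conjE mulrBr [w n * (_ * _)]mulrA w1 mul1r.
    by rewrite addrC subrKA subrr.
  apply: (finite_mirrors fin wp) => [n|n k [/wI]] //.
  split; first by rewrite mirrorE addrC subrK.
  apply/placesP => //; apply/eqP; rewrite -subr_eq0; apply/eqP.
  transitivity ((q^* - p^*) * w n ^+ 2 + (p - a * p^* - b) * w n + a * (p - q));
    first by ring.
  by rewrite k2 k1 k0 !mul0r !addr0.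
exists u, s; split=> //; rewrite sE.
by apply: SolvableSub => //; apply: SolvableMul.
Qed.

(** Turning a direction [v] by a right angle changes the sign of [v / v^*]. *)
Lemma perpendicularP a b c d : is_mirror a b -> is_mirror c d ->
  perpendicular (mirror a b) (mirror c d) <-> a = - c.
Proof.
move=> ab cd; have dotE x y : dot x y = 0 <-> x^* * y + x * y^* = 0.
  rewrite /dot; have -> : x * y^* = (x^* * y)^* by rewrite conjM conjK.
  case: (x^* * y) => r t /=; split => [->|].
    by apply/eqP; rewrite eq_complex /= addr0 subrr !eqxx.
  move/eqP; rewrite eq_complex /= => /andP[/eqP + _].
  by rewrite -mulr2n => /eqP; rewrite mulrn_eq0 => /eqP.
split=> [[p [x [q [y [x0 y0 El Em /dotE xy]]]]]|ac].
  have x'0 : x^* != 0 by rewrite conj_eq0.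
  have y'0 : y^* != 0 by rewrite conj_eq0.
  have [-> _] := mirror_inj ab (is_mirror_dir p x0) (etrans El (line_mirror p x0)).
  have [-> _] := mirror_inj cd (is_mirror_dir q y0) (etrans Em (line_mirror q y0)).
  apply: (mulIf x'0); rewrite divfK //; apply: (mulIf y'0).
  have -> : - (y / y^*) * x^* * y^* = - (x^* * y) by fld.
  by apply/eqP; rewrite -addr_eq0 addrC xy.
have [v v0 Dv] := mirror_dir ab.1; have [w w0 Dw] := mirror_dir cd.1.
have v'0 : v^* != 0 by rewrite conj_eq0.
have w'0 : w^* != 0 by rewrite conj_eq0.
exists (b / 2%:R), v, (d / 2%:R), w; split=> //.
- by apply: mirror_line => //; apply: mirror_half.
- by apply: mirror_line => //; apply: mirror_half.
have Ev : v = - (w / w^*) * v^* by rewrite -Dw -ac Dv divfK.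
by apply/dotE; rewrite [v in v * w^*]Ev; fld.
Qed.

(** Perpendicularity gives [u = - c], and [s] solves a linear equation. That equation degenerates
    only if all parallels to the fold are folds. *)
Lemma solvable_O7 p l m f : solv p -> solvable_line l -> solvable_line m ->
  finite_set (O7_folds p l m) -> O7_folds p l m f -> solvable_line f.
Proof.
move=> sp [a [b [sa sb ab ->]]] [c [d [sc sd cd ->]]] fin [fm fp].
have [u [s [us Df]]] := places_line fp; subst f.
have E1 := (placesP p us ab).1 fp; have uc := (perpendicularP us cd).1 fm.
have su : solv u by rewrite uc; apply: solvN.
exists u, s; split=> //.
have [ua|ua] := eqVneq (u + a) 0; last exact: (solv_fold_offset su sa sb sp ua E1).
exfalso; have [w [wI wu]] := perpendicular_family us.1.
apply: (finite_mirrors fin (u := fun=> u) (s := w)) => // [n|n k [/wI]] //.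
rewrite ua mulr0 in E1.
by split; [apply/perpendicularP | apply/placesP => //; rewrite ua mulr0].
Qed.

Lemma solvable_O4 p l f : solv p -> solvable_line l -> perpendicular f l -> f p ->
  solvable_line f.
Proof.
move=> sp [a [b [sa sb ab ->]]] fl; have [x [v [q [y [v0 _ Df _ _]]]]] := fl.
have us := is_mirror_dir x v0; rewrite (line_mirror x v0) in Df.
set u := v / v^* in us Df; set s := x - _ in us Df; subst f => fp.
have uc := (perpendicularP us ab).1 fl.
have su : solv u by rewrite uc; apply: solvN.
exists u, s; split=> //.
have -> : s = p - u * p^*; last first.
  by apply: SolvableSub => //; apply: SolvableMul => //; apply: solv_conj.
by move: fp; rewrite mirrorE => {1}->; rewrite addrAC subrr add0r.
Qed.

Lemma solvable_O2 p q : solv p -> solv q -> p != q ->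
  solvable_line (perp_bisector p q).
Proof.
move=> sp sq pq; have v0 : p - q != 0 by rewrite subr_eq0.
have v'0 : (p - q)^* != 0 by rewrite conj_eq0.
have vv : p^* - q^* != 0 by rewrite conjD conjN in v'0.
have sa : solv (- ((p - q) / (p - q)^*)).
  by apply/solvN/solv_div; [| apply: solv_conj]; apply: SolvableSub.
exists (- ((p - q) / (p - q)^*)), (p + (p - q) / (p - q)^* * q^*); split=> //.
- rewrite -[_ / _ * _]opprK -mulNr; apply: SolvableSub => //.
  by apply: SolvableMul => //; apply: solv_conj.
- by split; rewrite !conjE; fld.
apply/seteqP; split=> z.
  move=> E; have : `|z - p| ^+ 2 = `|z - q| ^+ 2 by rewrite E.
  rewrite !sqr_norm !conjE => E2; rewrite mirrorE.
  apply: (mulIf vv).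
  transitivity (- (p - q) * z^* + p * (p^* - q^*) + (p - q) * q^*); last by fld.
  apply/eqP; rewrite -subr_eq0; apply/eqP.
  transitivity ((z - q) * (z^* - q^*) - (z - p) * (z^* - p^*)); first by ring.
  by rewrite E2 subrr.
rewrite mirrorE !conjE => E; rewrite /perp_bisector.
have : `|z - p| ^+ 2 = `|z - q| ^+ 2.
  rewrite !sqr_norm !conjE; apply/eqP; rewrite -subr_eq0; apply/eqP.
  transitivity (- (z * (p^* - q^*) + (p - q) * z^* - p * p^* + q * q^*)); first by ring.
  by rewrite {1}E; fld.
by move/eqP; rewrite eqrXn2 // => /eqP.
Qed.

Lemma mirror_meet a b c d z : a != c -> mirror a b z -> mirror c d z ->
  solv a -> solv b -> solv c -> solv d -> solv z.
Proof.
move=> ac; rewrite !mirrorE => E1 E2 sa sb sc sd.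
have ac0 : a - c != 0 by rewrite subr_eq0.
have zE : z^* = (d - b) / (a - c).
  apply: (mulIf ac0); rewrite divfK // mulrBr.
  apply/eqP; rewrite -subr_eq0; apply/eqP.
  transitivity ((a * z^* + b) - (c * z^* + d)); first by ring.
  by rewrite -E1 -E2 subrr.
rewrite -[z]conjK; apply: solv_conj; rewrite zE.
by apply: solv_div; apply: SolvableSub.
Qed.

(** For meeting lines, [|u| = |v|] implies that the coefficient of the bisector is a square root of
    [a c]. For parallel lines, the offset is the mean of [b] and [d]. *)
Lemma solvable_O3 l m f : solvable_line l -> solvable_line m -> l <> m ->
  angle_bisector l m f -> solvable_line f.
Proof.
move=> [a [b [sa sb ab ->]]] [c [d [sc sd cd ->]]] lm [p u v u0 uv El Em|p q u u0 El Em].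
  have u'0 : u^* != 0 by rewrite conj_eq0.
  have v0 : v != 0 by rewrite -normr_gt0 -uv normr_gt0.
  have v'0 : v^* != 0 by rewrite conj_eq0.
  have Da := mirror_inj ab (is_mirror_dir p u0) (etrans El (line_mirror p u0)).
  have Dc := mirror_inj cd (is_mirror_dir p v0) (etrans Em (line_mirror p v0)).
  have ac : a != c.
    apply/eqP => ac; apply: lm; rewrite Da.2 Dc.2 -Da.1 -Dc.1 ac //.
  have pl : mirror a b p by rewrite El; exists 0; rewrite (_ : 0%:C = 0) // mul0r addr0.
  have pm : mirror c d p by rewrite Em; exists 0; rewrite (_ : 0%:C = 0) // mul0r addr0.
  have sp := mirror_meet ac pl pm sa sb sc sd.
  have uv0 : u + v != 0.
    apply: contraNneq ac => /eqP; rewrite addr_eq0 => /eqP Euv.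
    by rewrite Da.1 Dc.1 Euv conjN invrN mulrNN.
  have N : u * u^* = v * v^* by rewrite -!sqr_norm uv.
  have sw : solv ((u + v) / (u + v)^*).
    have := solv_root2 (z := (u + v) / (u + v)^*) (solv1 _) (solv0 _) (solvN (SolvableMul sa sc)).
    apply; first by rewrite oner_eq0.
    have w'0 : u^* + v^* != 0 by rewrite -conjD conj_eq0.
    rewrite Da.1 Dc.1 !conjE.
    transitivity ((u * u^* - v * v^*) * (u * v^* - v * u^*)
      / ((u^* + v^*) ^+ 2 * u^* * v^*)); first by fld.
    by rewrite N subrr !mul0r.
  exists ((u + v) / (u + v)^*), (p - (u + v) / (u + v)^* * p^*); split=> //.
  - by apply: SolvableSub => //; apply: SolvableMul => //; apply: solv_conj.
  - exact: is_mirror_dir.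
  - exact: line_mirror.
have Da := mirror_inj ab (is_mirror_dir p u0) (etrans El (line_mirror p u0)).
have Dc := mirror_inj cd (is_mirror_dir q u0) (etrans Em (line_mirror q u0)).
have u'0 : u^* != 0 by rewrite conj_eq0.
have E : (p + q) / 2%:R - u / u^* * ((p + q) / 2%:R)^* = (b + d) / 2%:R.
  by rewrite Da.2 Dc.2 !conjE; fld.
exists (u / u^*), ((b + d) / 2%:R); split.
- by rewrite -Da.1.
- apply: solv_div; first exact: solvD.
  by rewrite -natr1; apply: solvD; apply: solv1.
- by rewrite -E; apply: is_mirror_dir.
- by rewrite line_mirror // E.
Qed.
End MirrorFolds.

(** * Unit complex numbers and roots of unity *)

Section Cis.
Context {R : realType}.
Local Notation C := R[i].
Implicit Types s t : R.

Lemma cisD s t : cis (s + t) = cis s * cis t :> C.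
Proof.
apply/eqP; rewrite eq_complex /= cosD sinD eqxx /=; apply/eqP; ring.
Qed.

Lemma cis0 : cis 0 = 1 :> C.
Proof. by rewrite /cis cos0 sin0. Qed.

Lemma cisX t n : cis (t *+ n) = cis t ^+ n :> C.
Proof.
elim: n => [|n IHn]; first by rewrite cis0.
by rewrite mulrS cisD IHn exprS.
Qed.

Lemma cis_2pi : cis (pi *+ 2) = 1 :> C.
Proof. by rewrite /cis cos2pi sin2pi. Qed.

Lemma cisC t : (cis t)^* = cis (- t) :> C.
Proof. by apply/eqP; rewrite eq_complex /= cosN sinN !eqxx. Qed.

Lemma cis_neq0 t : cis t != 0 :> C.
Proof.
apply/eqP => t0; have := cisD t (- t).
by rewrite subrr cis0 t0 mul0r => /eqP; rewrite oner_eq0.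
Qed.

Lemma cis_regular (n j : nat) : (0 < n)%N ->
  cis (2 * pi * j%:R / n%:R) = cis (pi *+ 2 / n%:R) ^+ j :> C.
Proof.
move=> n0; rewrite -cisX; congr cis; rewrite -mulr_natr; ring.
Qed.

Lemma cis_regularXn (n : nat) : (0 < n)%N -> cis (pi *+ 2 / n%:R) ^+ n = 1 :> C.
Proof.
move=> n0; rewrite -cisX -[X in cis X]mulr_natr divfK ?cis_2pi //.
by rewrite pnatr_eq0 -lt0n.
Qed.

Lemma cis_regular_neq1 (n : nat) : (2 < n)%N -> cis (pi *+ 2 / n%:R) != 1 :> C.
Proof.
move=> n2; have n0 : 0 < n%:R :> R by rewrite ltr0n ltnW // ltnW.
have : 0 < sin (pi *+ 2 / n%:R : R).
  apply: sin_gt0_pi; rewrite -[pi *+ 2]mulr_natr; apply/andP; split.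
    by apply: divr_gt0 => //; apply: mulr_gt0 => //; apply: pi_gt0.
  by rewrite ltr_pdivrMr // ltr_pM2l ?pi_gt0 // ltr_nat.
by move=> s0; rewrite eq_complex negb_and; apply/orP; right; rewrite gt_eqF.
Qed.
End Cis.

(** * Regular constructions have solvable coordinates *)

Section RegularOrigami.
Context {R : realType}.
Local Notation C := R[i].
Local Notation solv := (@solvable_number C).

(** The first two vertices and the root of unity [zeta] determine [w] and [c] rationally, hence all
    the vertices. *)
Lemma solvable_regular_side n (A : seq C) i : (2 < n)%N -> regular_ngon n A ->
  solv A`_0 -> solv A`_1 -> (i < n)%N -> solvable_line (side_line A i).
Proof.
move=> n2 [sA [c [w [w0 AE]]]] s0 s1 lt_in.
have n0 : (0 < n)%N by rewrite ltnW // ltnW.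
pose zeta : C := cis (pi *+ 2 / n%:R).
have zn : zeta ^+ n = 1 by apply: cis_regularXn.
have sz : solv zeta by apply: SolvableUnity n0 zn.
have z1 : zeta - 1 != 0 by rewrite subr_eq0 cis_regular_neq1.
have {}AE j : (j < n)%N -> A`_j = c + w * zeta ^+ j.
  by move=> jn; rewrite AE // cis_regular.
have E0 : A`_0 = c + w by rewrite AE // expr0 mulr1.
have E1 : A`_1 = c + w * zeta by rewrite AE ?expr1 // ltnW.
have sw : solv w.
  have -> : w = (A`_1 - A`_0) / (zeta - 1) by rewrite E0 E1; fld.
  by apply: solv_div; apply: SolvableSub => //; apply: solv1.
have sc : solv c.
  have -> : c = A`_0 - w by rewrite E0 addrK.
  exact: SolvableSub.
have nextE : next_vertex A i = c + w * zeta ^+ i.+1.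
  by rewrite /next_vertex sA AE ?ltn_mod // expr_mod.
have sj j : solv (c + w * zeta ^+ j).
  by apply: solvD => //; apply: SolvableMul => //; apply: solvX.
rewrite /side_line nextE AE //; apply: solvable_line_points; rewrite ?sj //.
rewrite -subr_eq0 opprD addrACA subrr add0r -mulrBr mulf_neq0 //.
rewrite exprSr -[X in X - _]mulr1 -mulrBr mulf_neq0 //.
  by rewrite expf_neq0 // cis_neq0.
by rewrite -opprB oppr_eq0.
Qed.

Definition solvable_object (o : object) :=
  match o with Point z => solv z | Line l => solvable_line l end.

Lemma parallel_mirror (a b c d : C) : is_mirror a b -> is_mirror c d -> a = c ->
  parallel (mirror a b) (mirror c d).
Proof.
move=> ab cd ac; subst c; have [v v0 Dv] := mirror_dir ab.1.
exists (b / 2%:R), (d / 2%:R), v; split=> //.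
  by apply: mirror_line => //; apply: mirror_half.
by apply: mirror_line => //; apply: mirror_half.
Qed.

Lemma HJA_solvable (G : set object) o :
  (forall o', G o' -> solvable_object o') -> HJA G o -> solvable_object o.
Proof.
move=> sG [p q /sG sp /sG sq pq|p q /sG sp /sG sq pq|l m f /sG sl /sG sm lm bf
  |p l f /sG sp /sG sl fl fp|p q l f /sG sp /sG sq /sG sl fin ff
  |p q l m f /sG sp /sG sq /sG sl /sG sm fin ff
  |p l m f /sG sp /sG sl /sG sm fin ff|l m z /sG sl /sG sm lm lz mz] /=.
- exact: solvable_line_points.
- exact: solvable_O2.
- exact: (solvable_O3 sl sm lm bf).
- exact: (solvable_O4 sp sl fl fp).
- exact: (solvable_O5 sp sq sl fin ff).
- exact: (solvable_O6 sp sq sl sm fin ff).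
- exact: (solvable_O7 sp sl sm fin ff).
have [a [b [sa sb ab Dl]]] := sl; have [c [d [sc sd cd Dm]]] := sm; subst l m.
apply: (mirror_meet _ lz mz) => //; apply/eqP => ac.
by apply: lm; apply: parallel_mirror.
Qed.

Lemma O_RP_solvable z : O_RP R z -> solv z.
Proof.
move=> [G cG Gz]; suff sG : forall o, G o -> solvable_object o by exact: (sG (Point z)).
clear z Gz.
elim: cG => {G} [ o [|] -> | G o cG sG ro o' [-> | /sG]] //=.
- exact: solv0.
- exact: solv1.
case: ro => [|[n n3]]; first exact: HJA_solvable.
case=> A B i AG regA regB B0 B1 lt_in /=.
(* The polygon [B] is determined by its first two vertices, which are given vertices of [A]. *)
apply: (solvable_regular_side n3 regB) => //.
  by rewrite B0; apply: (sG (Point _)); apply: AG; rewrite mem_nth // regA.1.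
rewrite B1; apply: (sG (Point _)); apply: AG; rewrite mem_nth // regA.1.
by rewrite ltnS ltnW // ltnW.
Qed.
End RegularOrigami.

(** * Cyclic polygons *)

Section CyclicPolygons.
Context {R : realType}.
Local Notation C := R[i].
Implicit Types (c w : C) (r s t x : R).

Lemma sin_triple p q : sin (q *+ 2) + sin (p *+ 2) - sin ((p + q) *+ 2)
  = 4%:R * sin p * sin q * sin (p + q) :> R.
Proof.
have := cos2Dsin2 p; have := cos2Dsin2 q.
rewrite mulrnDl !mulr2n !(sinD, cosD).
move: (cos p) (cos q) (sin p) (sin q) => P Q S T EQ EP.
apply/eqP; rewrite -subr_eq0; apply/eqP.
transitivity (2 * T * Q * (1 - (P ^+ 2 + S ^+ 2))
  + 2 * S * P * (1 - (Q ^+ 2 + T ^+ 2))); first by ring.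
by rewrite EQ EP subrr !mulr0 addr0.
Qed.

Lemma norm_cis t : `|cis t| = 1 :> C.
Proof.
apply/eqP; rewrite -(@eqrXn2 _ 2) // expr1n sqr_norm cisC -cisD subrr.
by rewrite cis0.
Qed.

(** This is twice the signed area of an inscribed triangle, as a product of sines of half arcs
    ([sin_triple]); convexity thus reduces to signs of sines. *)
Lemma cross_circle c w r s t x : `|w| = r%:C ->
  cross ((c + w * cis t) - (c + w * cis s)) ((c + w * cis x) - (c + w * cis s))
  = 4%:R * r ^+ 2 * sin ((t - s) / 2) * sin ((x - t) / 2) * sin ((x - s) / 2).
Proof.
move=> wr; have N : w^* * w = (r ^+ 2)%:C.
  by rewrite mulrC -sqr_norm wr rmorphXn.
rewrite /cross.
have -> : (c + w * cis t - (c + w * cis s))^* * (c + w * cis x - (c + w * cis s))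
    = (r ^+ 2)%:C * (cis (x - t) - cis (x - s) - cis (s - t) + 1).
  rewrite -N !conjE !cisC !cisD -[in RHS](cis0 (R := R)) -(subrr s) cisD; ring.
have ImM (y : R) (z : C) : complex.Im (y%:C * z) = y * complex.Im z.
  by case: z => z1 z2 /=; rewrite mul0r addr0.
rewrite ImM /=.
have -> : 4%:R * r ^+ 2 * sin ((t - s) / 2) * sin ((x - t) / 2) * sin ((x - s) / 2)
  = r ^+ 2 * (4%:R * sin ((t - s) / 2) * sin ((x - t) / 2) * sin ((x - s) / 2)).
  by ring.
have -> : (x - s) / 2 = (t - s) / 2 + (x - t) / 2 by field.
rewrite -sin_triple; congr (_ * _).
have -> : ((x - t) / 2) *+ 2 = x - t by rewrite -mulr_natr divfK.
have -> : ((t - s) / 2) *+ 2 = t - s by rewrite -mulr_natr divfK.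
have -> : ((t - s) / 2 + (x - t) / 2) *+ 2 = x - s by rewrite -mulr_natr; field.
have -> : s - t = - (t - s) by rewrite opprB.
by rewrite sinN opprK addr0 addrAC.
Qed.

Lemma cross_center c w r s t : `|w| = r%:C ->
  cross ((c + w * cis t) - (c + w * cis s)) (c - (c + w * cis s))
  = r ^+ 2 * sin (t - s).
Proof.
move=> wr; have N : w^* * w = (r ^+ 2)%:C.
  by rewrite mulrC -sqr_norm wr rmorphXn.
rewrite /cross.
have -> : (c + w * cis t - (c + w * cis s))^* * (c - (c + w * cis s))
    = (r ^+ 2)%:C * (1 - cis (s - t)).
  rewrite -N !conjE !cisC !cisD -[in RHS](cis0 (R := R)) -(subrr s) cisD; ring.
have ImM (y : R) (z : C) : complex.Im (y%:C * z) = y * complex.Im z.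
  by case: z => z1 z2 /=; rewrite mul0r addr0.
by rewrite ImM /= -sinN opprB add0r.
Qed.

Lemma norm_chord c w r s t : `|w| = r%:C -> 0 <= r -> s <= t <= s + pi *+ 2 ->
  `|(c + w * cis t) - (c + w * cis s)| = (2 * r * sin ((t - s) / 2))%:C.
Proof.
move=> wr r0 /andP[st ts]; apply/eqP.
have sin0 : 0 <= sin ((t - s) / 2).
  apply: sin_ge0_pi; rewrite divr_ge0 ?subr_ge0 //=.
  by rewrite ler_pdivrMr // mulr_natr lerBlDl.
rewrite -(@eqrXn2 _ 2) //; last by rewrite lecR !mulr_ge0.
rewrite opprD addrACA subrr add0r -mulrBr normrM exprMn wr sqr_norm.
rewrite conjD conjN !cisC -!rmorphXn /=.
have -> : (cis t - cis s) * (cis (- t) - cis (- s))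
    = (2 - 2 * cos (t - s))%:C :> C.
  apply/eqP; rewrite eq_complex /= !cosN !sinN cosB.
  apply/andP; split; apply/eqP; last by ring.
  have := cos2Dsin2 t; have := cos2Dsin2 s => Es Et.
  transitivity ((cos t ^+ 2 + sin t ^+ 2) + (cos s ^+ 2 + sin s ^+ 2)
    - 2 * (cos t * cos s + sin t * sin s)); first by ring.
  by rewrite Es Et.
rewrite -rmorphM /=; apply/eqP; congr (_%:C).
pose h := (t - s) / 2; have Dts : t - s = h *+ 2 by rewrite -mulr_natr /h divfK.
rewrite -/h Dts cos_mulr2n cos2sin2 mulr2n; ring.
Qed.

(** * Polygons inscribed at increasing angles *)

Section Cyclic.
Variables (n : nat) (phi : nat -> R) (A : seq C) (c w : C) (r : R).
Hypothesis n_ge3 : (2 < n)%N.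
Hypothesis phi_lt : forall i, (i < n)%N -> phi i < phi i.+1.
Hypothesis phi_n : phi n = phi 0%N + pi *+ 2.
Hypothesis sA : size A = n.
Hypothesis AE : forall j, (j < n)%N -> A`_j = c + w * cis (phi j).
Hypothesis wr : `|w| = r%:C.
Hypothesis r_gt0 : 0 < r.

Let n_gt0 : (0 < n)%N. Proof. by apply: leq_trans n_ge3. Qed.

Let phi_mono i j : (i < j)%N -> (j <= n)%N -> phi i < phi j.
Proof.
elim: j => // j IHj; rewrite ltnS leq_eqVlt => /orP[/eqP -> |ij] jn.
  exact: phi_lt.
by apply: lt_trans (phi_lt jn); apply: IHj => //; apply: ltnW.
Qed.

Let phi_monoW i j : (i <= j)%N -> (j <= n)%N -> phi i <= phi j.
Proof.
by rewrite leq_eqVlt => /orP[/eqP -> //|ij] jn; apply/ltW/phi_mono.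
Qed.

Let nextE i : (i < n)%N -> next_vertex A i = c + w * cis (phi i.+1).
Proof.
move=> lt_in; rewrite /next_vertex sA.
move: (lt_in); rewrite leq_eqVlt => /orP[/eqP En|lt_i1n]; last by rewrite modn_small ?AE.
by rewrite En modnn AE // phi_n cisD cis_2pi mulr1.
Qed.

Lemma cyclic_gap i : (i < n)%N -> 0 < phi i.+1 - phi i < pi *+ 2.
Proof.
move=> lt_in; rewrite subr_gt0 phi_lt //= ltrBlDr.
have [i0|i0] := posnP i.
  by rewrite i0 addrC -phi_n; apply: phi_mono => //; apply: ltnW.
have -> : pi *+ 2 + phi i = phi n + (phi i - phi 0) by rewrite phi_n; ring.
have := phi_monoW lt_in (leqnn n); have := phi_mono i0 (ltnW lt_in); lra.
Qed.

Lemma cyclic_convex : convex_ccw A.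
Proof.
move=> i j; rewrite sA => lt_in lt_jn ji ji1.
(* Choose the angle [x] of the [j]-th vertex within the turn that starts at [phi i]: [phi j] if
   [j > i], and [phi j + 2 pi] if [j < i]. All three half arcs then lie strictly between 0 and
   [pi]. *)
have [x [Ax x1 x2]] : exists x, [/\ A`_j = c + w * cis x, phi i.+1 < x
    & x < phi i + pi *+ 2].
  have [lt_ij|le_ji] := ltnP i j.
    exists (phi j); split; first exact: AE.
      apply: phi_mono; last exact: ltnW.
      rewrite ltn_neqAle lt_ij andbT eq_sym.
      by move: ji1; rewrite modn_small // (leq_trans _ lt_jn).
    apply: (lt_le_trans (phi_mono lt_jn (leqnn n))).
    by rewrite phi_n lerD2r; apply: phi_monoW => //; apply: ltnW.
  have lt_ji : (j < i)%N by rewrite ltn_neqAle ji.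
  exists (phi j + pi *+ 2); split.
  - by rewrite cisD cis_2pi mulr1 AE.
  - have [i1n|i1n] := eqVneq i.+1 n.
      rewrite i1n phi_n ltrD2r; apply: phi_mono; last exact: ltnW.
      by move: ji1; rewrite i1n modnn lt0n.
    apply: (lt_le_trans (y := phi n)).
      by apply: phi_mono => //; rewrite ltn_neqAle i1n.
    by rewrite phi_n lerD2r; apply: phi_monoW => //; apply: ltnW.
  - by rewrite ltrD2r; apply: phi_mono => //; apply: ltnW.
have gap := phi_lt lt_in.
rewrite nextE // Ax AE // (cross_circle _ _ _ _ wr).
have half (y : R) : 0 < y -> y < pi *+ 2 -> 0 < sin (y / 2).
  move=> y0 y2; apply: sin_gt0_pi; rewrite divr_gt0 //=.
  by rewrite ltr_pdivrMr // mulr_natr.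
have t1 := lt_trans gap x1.
rewrite !mulr_gt0 ?exprn_gt0 // half //; rewrite ?subr_gt0 // ltrBlDl //.
- exact: lt_trans x1 x2.
- by apply: lt_trans x2 _; rewrite ltrD2r.
Qed.

Lemma cyclic_central :
  (forall i, (i < n)%N -> phi i.+1 - phi i < pi) -> interior_ccw A c.
Proof.
move=> gap i; rewrite sA => lt_in.
rewrite nextE // AE // (cross_center _ _ _ wr) mulr_gt0 ?exprn_gt0 //.
by apply: sin_gt0_pi; rewrite subr_gt0 phi_lt //= gap.
Qed.

Lemma cyclic_Cy (a : seq R) : size a = n ->
  (forall i, (i < n)%N -> a`_i = 2 * r * sin ((phi i.+1 - phi i) / 2)) ->
  Cy a A`_0 A`_1 A c r.
Proof.
move=> sa aE; split=> //.
- split; first by rewrite sa.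
  move=> x xa; have [k] := nthP 0 xa; rewrite sa => lt_in <-; rewrite aE //.
  have /andP[g0 g2] := cyclic_gap lt_in.
  rewrite !mulr_gt0 // sin_gt0_pi // divr_gt0 //=.
  by rewrite ltr_pdivrMr // mulr_natr.
- split; first by rewrite sA.
  rewrite sa => i lt_in; rewrite nextE // AE // aE //.
  have /andP[g0 g2] := cyclic_gap lt_in.
  apply: norm_chord => //; first exact: ltW.
  by apply/andP; split; move: g0 g2; lra.
- exact: cyclic_convex.
move=> z zA; have [k] := nthP 0 zA; rewrite sA => lt_in <-.
by rewrite AE // addrC addKr normrM wr norm_cis mulr1.
Qed.
End Cyclic.

Lemma polygon_ineq_bound (a : seq R) M : 0 <= M -> (forall x, x \in a -> x <= M) ->
  2 * M < \sum_(x <- a) x -> polygon_ineq a.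
Proof.
move=> M0 aM; rewrite /polygon_ineq; apply: le_lt_trans.
rewrite ler_pM2l //; elim: a aM => [|y a IHa] aM; first by rewrite big_nil.
rewrite big_cons ge_max aM ?mem_head //=.
by apply: IHa => x xa; apply: aM; rewrite inE xa orbT.
Qed.
End CyclicPolygons.

(** * Regular polygons as cyclic polygons *)

Section RegularCyclic.
Context {R : realType}.
Local Notation C := R[i].

Lemma regular_Cy n (A : seq C) : (2 < n)%N -> regular_ngon n A ->
  exists c r s, [/\ 0 < r, s = 2 * r * sin (pi / n%:R),
    Cy (nseq n s) A`_0 A`_1 A c r, `|A`_1 - A`_0| = s%:C & interior_ccw A c].
Proof.
move=> n2 [sA [c [w [w0 AE]]]].
have n0 : 0 < n%:R :> R by rewrite ltr0n ltnW // ltnW.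
have nN0 : n%:R != 0 :> R by rewrite gt_eqF.
pose phi j : R := 2 * pi * j%:R / n%:R.
have gapE j : phi j.+1 - phi j = pi *+ 2 / n%:R.
  by rewrite /phi -natr1 -[pi *+ 2]mulr_natr; field.
have gap0 : 0 < pi *+ 2 / n%:R :> R.
  by rewrite divr_gt0 // -mulr_natr mulr_gt0 ?pi_gt0.
have phi_lt i : (i < n)%N -> phi i < phi i.+1 by rewrite -subr_gt0 gapE.
have phi_n : phi n = phi 0%N + pi *+ 2.
  by rewrite /phi -[pi *+ 2]mulr_natr; field.
pose r := complex.Re `|w|; have wr : `|w| = r%:C by [].
have r0 : 0 < r by rewrite -ltcR -wr normr_gt0.
pose s := 2 * r * sin (pi / n%:R).
have CyA : Cy (nseq n s) A`_0 A`_1 A c r.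
  apply: (cyclic_Cy n2 phi_lt phi_n sA AE wr r0); first exact: size_nseq.
  move=> i lt_in; rewrite nth_nseq lt_in gapE /s; congr (_ * sin _).
  by rewrite -[pi *+ 2]mulr_natr; field.
exists c, r, s; split=> //.
  have [_ [_ sides] _ _ _] := CyA.
  have := sides 0%N; rewrite size_nseq nth_nseq (ltnW (ltnW n2)) => /(_ isT) <-.
  by rewrite /next_vertex sA modn_small // ltnW.
apply: (cyclic_central n2 phi_lt phi_n sA AE wr r0) => i _; rewrite gapE.
by rewrite ltr_pdivrMr // -[pi *+ 2]mulr_natr ltr_pM2l ?pi_gt0 // ltr_nat.
Qed.

(** The common side gives [rA sin(pi/(n+1)) = rB sin(pi/n)]. Since the sine increases up to [pi/2],
    the circumradius of the [n]-gon is the smaller one. *)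
Lemma RPA_CPA n (G : set object) (o : @object R) : (2 < n)%N ->
  RPA n G o -> CPA n 1 G o.
Proof.
move=> n2 [A B i AG regA regB B0 B1 lt_in].
have n3 : (2 < n.+1)%N by apply: ltnW.
have [cA [rA [s [rA0 sAE CyA sideA intA]]]] := regular_Cy n3 regA.
have [cB [rB [t [rB0 tBE CyB sideB _]]]] := regular_Cy n2 regB.
have st : t = s by move: sideB; rewrite B0 B1 sideA => /complexI.
rewrite st in tBE CyB; rewrite B0 B1 in CyB.
have n0 : 0 < n%:R :> R by rewrite ltr0n ltnW // ltnW.
have s0 : 0 < s by have [[_ +] _ _ _ _] := CyB; apply; apply/nseqP; rewrite (ltnW (ltnW n2)).
have takeE : take n (nseq n.+1 s) = nseq n s.
  by rewrite take_nseq.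
apply: (@CPA_fold _ n 1 G (nseq n.+1 s) A B cA rA cB rB i) => //.
- by rewrite size_nseq addn1.
- by rewrite takeE.
- have lt_sin : sin (pi / n.+1%:R) < sin (pi / n%:R) :> R.
    have bnd m : (2 < m)%N -> (pi / m%:R : R) \in `[- (pi / 2), pi / 2].
      move=> m2; have m0 : 0 < m%:R :> R by rewrite ltr0n ltnW // ltnW.
      rewrite in_itv /=; apply/andP; split.
        apply: (@le_trans _ _ 0); last by rewrite divr_ge0 ?pi_ge0 // ltW.
        by rewrite oppr_le0 divr_ge0 ?pi_ge0.
      by rewrite ler_pM2l ?pi_gt0 // lef_pV2 ?posrE // ler_nat ltnW.
    rewrite ltr_sin ?bnd // ltr_pM2l ?pi_gt0 // ltf_pV2 ?posrE ?ltr_nat //.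
  have sinA : 0 < sin (pi / n.+1%:R) :> R.
    by move: s0; rewrite sAE pmulr_rgt0 // mulr_gt0.
  have E : rA * sin (pi / n.+1%:R) = rB * sin (pi / n%:R).
    by apply: (@mulfI _ 2) => //; rewrite !mulrA -sAE -tBE.
  rewrite -(ltr_pM2r sinA) E ltr_pM2l //.
- rewrite takeE; apply: (@polygon_ineq_bound _ _ s); first exact: ltW.
    by move=> x; rewrite mem_nseq => /andP[_ /eqP ->].
  by rewrite big_nseq iter_addr addr0 -[s *+ n]mulr_natr mulrC ltr_pM2l // ltr_nat.
Qed.

Lemma O_RP_sub_O_CP : O_RP R `<=` O_CP R.
Proof.
move=> z [G cG Gz]; exists G => //; elim: cG {z Gz} => [|{}G o cG cG' ax].
  exact: Start.
apply: Step => //; case: ax => [ax|[n n3 ax]]; [by left | right].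
by exists n, 1%N; split=> //; [left | apply: RPA_CPA].
Qed.
End RegularCyclic.

(** * Constructible coordinates form a field *)

Section Constructible.
Context {R : realType}.
Local Notation C := R[i].
Implicit Types (p q u v z : C) (x y : R) (l m : set C) (S G : set (@object R)).

Lemma HJA_mono G G' (o : @object R) : G `<=` G' -> HJA G o -> HJA G' o.
Proof.
move=> GG' [p q /GG' Gp /GG' Gq pq|p q /GG' Gp /GG' Gq pq
  |l m f /GG' Gl /GG' Gm lm bf|p l f /GG' Gp /GG' Gl fl fp
  |p q l f /GG' Gp /GG' Gq /GG' Gl fin ff
  |p q l m f /GG' Gp /GG' Gq /GG' Gl /GG' Gm fin ff
  |p l m f /GG' Gp /GG' Gl /GG' Gm fin ff|l m z /GG' Gl /GG' Gm lm lz mz].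
- exact: O1.
- exact: O2.
- exact: (O3 Gl Gm lm bf).
- exact: (O4 Gp Gl fl fp).
- exact: (O5 Gp Gq Gl fin ff).
- exact: (O6 Gp Gq Gl Gm fin ff).
- exact: (O7 Gp Gl Gm fin ff).
- exact: (LI Gl Gm lm lz mz).
Qed.

Lemma cyclic_axioms_mono G G' (o : @object R) :
  G `<=` G' -> cyclic_axioms G o -> cyclic_axioms G' o.
Proof.
move=> GG' [ax|[n [k [n3 k12 ax]]]]; first by left; apply: HJA_mono ax.
right; exists n, k; split=> //.
by case: ax => a P1 P2 c1 r1 c2 r2 j GP; apply: CPA_fold => z /GP /GG'.
Qed.

Lemma construction_start (ax : @axioms R) G :
  construction ax G -> [set Point 0; Point 1] `<=` G.
Proof.
elim=> [//|{}G o _ IHG _ o' /IHG]; by right.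
Qed.

(** The second construction is replayed on top of the first: the axioms remain applicable when more
    objects are given. *)
Lemma construction_union G G' :
  construction cyclic_axioms G -> construction cyclic_axioms G' ->
  exists2 H, construction cyclic_axioms H & G `<=` H /\ G' `<=` H.
Proof.
move=> cG; elim=> [|{}G' o _ [H cH [GH G'H]] ax].
  by exists G => //; split=> //; apply: construction_start cG.
exists (o |` H); first by apply: Step => //; apply: cyclic_axioms_mono ax.
split=> [ o' /GH|o' [->|/G'H]]; [by right | by left | by right].
Qed.

(** An axiom takes several given objects at once, so objects that are constructible separately have
    to be gathered in a single construction. *)
Definition covered S := exists2 G, construction cyclic_axioms G & S `<=` G.
Definition constr (o : @object R) := exists2 G, construction cyclic_axioms G & G o.

Lemma covered0 : covered set0.
Proof. by exists [set Point 0; Point 1]; [exact: Start | exact: sub0set]. Qed.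

Lemma coveredU1 o S : constr o -> covered S -> covered (o |` S).
Proof.
move=> [G cG Go] [G' cG' SG']; have [H cH [GH G'H]] := construction_union cG cG'.
by exists H => // o' [->|/SG'/G'H //]; apply: GH.
Qed.

Lemma constr_axiom S o : covered S -> cyclic_axioms S o -> constr o.
Proof.
move=> [G cG SG] ax; exists (o |` G); last by left.
by apply: Step => //; apply: cyclic_axioms_mono ax.
Qed.

Lemma constr_HJA S o : covered S -> HJA S o -> constr o.
Proof. by move=> cS ax; apply: constr_axiom cS _; left. Qed.

Lemma covered_points (A : seq C) :
  (forall z, z \in A -> constr (Point z)) ->
  covered [set o | exists2 z, z \in A & o = Point z].
Proof.
elim: A => [|z A IHA] cA; first by case: covered0 => G cG _; exists G => // o [].
have cz : constr (Point z) by apply: cA; rewrite mem_head.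
have [|G cG AG] := coveredU1 cz (IHA _).
  by move=> y yA; apply: cA; rewrite inE yA orbT.
exists G => // _ [y + ->]; rewrite inE => /orP[/eqP -> | yA]; apply: AG.
  by left.
by right; exists y.
Qed.

Lemma constr0 : constr (Point 0).
Proof. by exists [set Point 0; Point 1]; [exact: Start | left]. Qed.

Lemma constr1 : constr (Point 1).
Proof. by exists [set Point 0; Point 1]; [exact: Start | right]. Qed.

Lemma constr_line p q : constr (Point p) -> constr (Point q) -> p != q ->
  constr (Line (line p q)).
Proof.
move=> cp cq pq; apply: (constr_HJA (coveredU1 cp (coveredU1 cq covered0))).
by apply: O1 => //; [left | right; left].
Qed.

Lemma crossE u v : cross u v = 0 <-> u * v^* = v * u^*.
Proof.
rewrite /cross; have -> : u * v^* = (u^* * v)^* by rewrite conjM conjK.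
rewrite [v * _]mulrC; case: (u^* * v) => s t /=; split=> [->|].
  by apply/eqP; rewrite eq_complex /= oppr0 !eqxx.
move=> /eqP; rewrite eq_complex /= eqxx /= => /eqP; lra.
Qed.

(** Parallel lines would have [u / u^* = v / v^*], which makes the cross product vanish. *)
Lemma constr_meet p u q v z : constr (Line (line p (p + u))) ->
  constr (Line (line q (q + v))) -> cross u v != 0 ->
  line p (p + u) z -> line q (q + v) z -> constr (Point z).
Proof.
move=> cl cm uv lz mz.
apply: (constr_HJA (coveredU1 cl (coveredU1 cm covered0))).
apply: (@LI _ _ (line p (p + u)) (line q (q + v))) => //; [by left | by right; left |].
move=> [p' [q' [w [w0 El Em]]]]; move/negP: uv; apply; apply/eqP/crossE.
have [->|u0] := eqVneq u 0; first by rewrite mul0r conjC0 mulr0.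
have [->|v0] := eqVneq v 0; first by rewrite mul0r conjC0 mulr0.
have u'0 : u^* != 0 by rewrite conj_eq0.
have v'0 : v^* != 0 by rewrite conj_eq0.
have [Eu _] := mirror_inj (is_mirror_dir p u0) (is_mirror_dir p' w0)
  (etrans (esym (line_mirror p u0)) (etrans El (line_mirror p' w0))).
have [Ev _] := mirror_inj (is_mirror_dir q v0) (is_mirror_dir q' w0)
  (etrans (esym (line_mirror q v0)) (etrans Em (line_mirror q' w0))).
apply: (mulIf (mulf_neq0 (invr_neq0 u'0) (invr_neq0 v'0))).
transitivity (u / u^*); first by fld.
by rewrite Eu -Ev; fld.
Qed.

Lemma constr_perp p q v : constr (Point p) -> constr (Line (line q (q + v))) ->
  v != 0 -> constr (Line (line p (p + 'i%C * v))).
Proof.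
move=> cp cl v0; apply: (constr_HJA (coveredU1 cp (coveredU1 cl covered0))).
apply: (@O4 _ _ p (line q (q + v))); [by left | by right; left | |].
  exists p, ('i%C * v), q, v; split=> //; first by rewrite mulf_neq0 // complex_i_neq0.
  rewrite /dot; case: v {v0 cl} => s t /=; ring.
by exists 0; rewrite (_ : 0%:C = 0) // mul0r addr0.
Qed.

Lemma line_point p v x : line p (p + v) (p + x%:C * v).
Proof. by exists x; rewrite [p + v]addrC addrK. Qed.

Ltac complex_ring := apply/eqP; rewrite eq_complex /=; apply/andP; split; apply/eqP; ring.

Ltac cross_value c :=
  rewrite (_ : cross _ _ = c); last (rewrite /cross /=; ring);
  rewrite ?oppr_eq0 ?oner_eq0 //.

Definition constr_real x := constr (Point x%:C).

Lemma constr_xaxis : constr (Line (line 0 (0 + 1))).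
Proof. by rewrite add0r; apply: (constr_line constr0 constr1); rewrite eq_sym oner_eq0. Qed.

Lemma constr_vertical p : constr (Point p) -> constr (Line (line p (p + 'i%C))).
Proof.
by move=> cp; have := constr_perp cp constr_xaxis (oner_neq0 _); rewrite mulr1.
Qed.

Lemma constr_horizontal p : constr (Point p) -> constr (Line (line p (p - 1))).
Proof.
move=> cp; have := constr_perp cp (constr_vertical constr0) (complex_i_neq0 (R := R)).
by rewrite -expr2 sqr_i.
Qed.

(** The bisector of the axes serves to carry a length from one axis to the other. *)
Lemma constr_diagonal : constr (Line (line 0 (0 + (1 + 'i%C)))).
Proof.
apply: (constr_HJA (coveredU1 constr_xaxis (coveredU1 (constr_vertical constr0) covered0))).
apply: (@O3 _ _ (line 0 (0 + 1)) (line 0 (0 + 'i%C))); [by left | by right; left | |].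
  move=> E; have : line 0 (0 + 1) (0 + 1%:C * 1 : C) by apply: line_point.
  rewrite E => -[t] /eqP; rewrite eq_complex /= => /andP[/eqP].
  lra.
apply: (@BisectorMeet _ _ _ 0 1 'i%C) => //.
by apply/eqP; rewrite -(@eqrXn2 _ 2) // !sqr_norm; apply/eqP; complex_ring.
Qed.

Lemma diagonal_neq0 : 1 + 'i%C != 0 :> C.
Proof. by rewrite eq_complex /= addr0 oner_eq0. Qed.

Lemma constr_diag_point y : constr_real y -> constr (Point (y +i* y)).
Proof.
move=> cy; apply: (constr_meet (constr_vertical cy) constr_diagonal).
- by cross_value (-1 : R).
- by exists y; complex_ring.
- by exists y; complex_ring.
Qed.

Lemma constr_complex x y : constr_real x -> constr_real y ->
  constr (Point (x +i* y)).
Proof.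
move=> cx cy.
apply: (constr_meet (constr_vertical cx) (constr_horizontal (constr_diag_point cy))).
- by cross_value (1 : R).
- by exists y; complex_ring.
- by exists (y - x); complex_ring.
Qed.

Lemma constr_Re z : constr (Point z) -> constr_real (complex.Re z).
Proof.
move=> cz; apply: (constr_meet (constr_vertical cz) constr_xaxis).
- by cross_value (-1 : R).
- by exists (- complex.Im z); case: z cz => x y _; complex_ring.
- by exists (complex.Re z); complex_ring.
Qed.

Lemma constr_Im z : constr (Point z) -> constr_real (complex.Im z).
Proof.
move=> cz; suff : constr (Point (complex.Im z +i* complex.Im z)) by move/constr_Re.
apply: (constr_meet (constr_horizontal cz) constr_diagonal).
- by cross_value (-1 : R).
- by exists (complex.Re z - complex.Im z); case: z cz => x y _; complex_ring.
- by exists (complex.Im z); complex_ring.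
Qed.

(** The perpendicular to the diagonal through [x + i y] meets the real axis at [x + y]. *)
Lemma constr_realD x y : constr_real x -> constr_real y -> constr_real (x + y).
Proof.
move=> cx cy.
have cl := constr_perp (constr_complex cx cy) constr_diagonal diagonal_neq0.
apply: (constr_meet cl constr_xaxis).
- by cross_value (-1 : R).
- by exists (- y); complex_ring.
- by exists (x + y); complex_ring.
Qed.

(** The parallel to the diagonal through [x + i y], drawn as a perpendicular to a perpendicular,
    meets the real axis at [x - y]. *)
Lemma constr_realB x y : constr_real x -> constr_real y -> constr_real (x - y).
Proof.
move=> cx cy; have i0 := complex_i_neq0 (R := R).
have cl := constr_perp (constr_complex cx cy)
  (constr_perp constr0 constr_diagonal diagonal_neq0) (mulf_neq0 i0 diagonal_neq0).
apply: (constr_meet cl constr_xaxis).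
- by cross_value (1 : R).
- by exists y; complex_ring.
- by exists (x - y); complex_ring.
Qed.

Lemma constr_real0 : constr_real 0. Proof. exact: constr0. Qed.
Lemma constr_real1 : constr_real 1. Proof. exact: constr1. Qed.

(** The line through 0 of slope [y] has height [x y] above [x]. *)
Lemma constr_realM x y : constr_real x -> constr_real y -> constr_real (x * y).
Proof.
move=> cx cy.
have cl : constr (Line (line 0 (0 + (1 +i* y)))).
  rewrite add0r; apply: constr_line; first exact: constr0.
    exact: constr_complex constr_real1 cy.
  by rewrite eq_complex /= eq_sym oner_eq0.
suff /constr_Im : constr (Point (x +i* (x * y))) by [].
apply: (constr_meet cl (constr_vertical cx)).
- by cross_value (1 : R).
- by exists x; complex_ring.
- by exists (x * y); complex_ring.
Qed.

(** The line through 0 and [y + i] has height [1/y] above 1. *)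
Lemma constr_realV y : constr_real y -> constr_real y^-1.
Proof.
move=> cy; have [->|y0] := eqVneq y 0; first by rewrite invr0; apply: constr0.
have cl : constr (Line (line 0 (0 + (y +i* 1)))).
  rewrite add0r; apply: constr_line; first exact: constr0.
    exact: constr_complex cy constr_real1.
  by rewrite eq_complex /= eq_sym (negPf y0).
suff /constr_Im : constr (Point (1 +i* y^-1)) by [].
apply: (constr_meet cl (constr_vertical constr1)).
- by cross_value y.
- exists y^-1; apply/eqP; rewrite eq_complex /=; apply/andP; split; apply/eqP; by field.
- by exists y^-1; complex_ring.
Qed.

Lemma constr_real_nat n : constr_real n%:R.
Proof.
elim: n => [|n IHn]; first exact: constr_real0.
by rewrite -natr1; apply: constr_realD => //; apply: constr_real1.
Qed.

Lemma constr_pointM p q : constr (Point p) -> constr (Point q) ->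
  constr (Point (p * q)).
Proof.
case: p q => a b [c d] cp cq.
have [/= ca cb] := (constr_Re cp, constr_Im cp).
have [/= cc cd] := (constr_Re cq, constr_Im cq).
by apply: constr_complex; [apply: constr_realB | apply: constr_realD]; apply: constr_realM.
Qed.
End Constructible.

(** * The quintic *)

(* Its roots are the inverses of those of [7 y^5 - 28 y^3 + 21 y - 20]; in this
   form Eisenstein's criterion applies. *)
Definition quintic : {poly int} := Poly [:: - 7%:Z; 0; 28; 0; - 21; 20].

Lemma quinticE : quintic = [:: - 7%:Z; 0; 28; 0; - 21; 20] :> seq int.
Proof. by rewrite (@PolyK _ 1). Qed.

Lemma horner_quintic (A : comNzRingType) (z : A) :
  (map_poly intr quintic).[z] = 20 * z ^+ 5 - 21 * z ^+ 4 + 28 * z ^+ 2 - 7.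
Proof.
rewrite map_polyE quinticE horner_Poly /=; ring.
Qed.

Lemma irreducible_quintic : irreducible_poly (map_poly intr quintic : {poly rat}).
Proof.
apply/irreducible_rat_int; apply: (@eisenstein_crit 7).
- by [].
- by rewrite quinticE.
- by rewrite lead_coefE quinticE.
- by rewrite quinticE.
by rewrite quinticE => -[|[|[|[|[|i]]]]].
Qed.

Section RealRoot.
Variable R : realType.
Implicit Types y z : R.

Let F y : R := y ^+ 5 - 4 * y ^+ 3 + 3 * y.

(** Since [F y = y (y^2 - 1) (y^2 - 3)], sign considerations leave two other ranges in which [F]
    could be positive. It is at most 2 on the negative one and at most 3/2 between 0 and 1, both
    below 20/7. *)
Lemma quintic_root_large y : F y = 20 / 7 -> 0 < y /\ 3 < y ^+ 2.
Proof.
have FE : F y = y * (y ^+ 2 - 1) * (y ^+ 2 - 3) by rewrite /F; ring.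
rewrite FE => Fy; have y2 : 0 <= y ^+ 2 by apply: sqr_ge0.
have [y_gt0|y_le0] := ltP 0 y; last first.
  exfalso; have a : 1 < y ^+ 2.
    rewrite ltNge; apply/negP => le.
    have : 0 <= - y * (1 - y ^+ 2) * (3 - y ^+ 2) by rewrite !mulr_ge0 //; lra.
    lra.
  have b : y ^+ 2 < 3.
    rewrite ltNge; apply/negP => le.
    have : 0 <= - y * (y ^+ 2 - 1) * (y ^+ 2 - 3) by rewrite !mulr_ge0 //; lra.
    lra.
  have y2b : - y <= 2 by rewrite leNgt; apply/negP => lt; nra.
  have c : 0 <= (y ^+ 2 - 1) * (3 - y ^+ 2) by rewrite mulr_ge0 //; lra.
  have d : (y ^+ 2 - 1) * (3 - y ^+ 2) <= 1.
    have := sqr_ge0 (y ^+ 2 - 2); nra.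
  have : - y * ((y ^+ 2 - 1) * (3 - y ^+ 2)) <= 2 * 1.
    by apply: ler_pM => //; lra.
  lra.
split=> //; rewrite ltNge; apply/negP => le3.
have lt1 : y ^+ 2 < 1.
  rewrite ltNge; apply/negP => le.
  have : 0 <= y * (y ^+ 2 - 1) * (3 - y ^+ 2) by rewrite !mulr_ge0 //; lra.
  lra.
have y1 : y < 1 by rewrite ltNge; apply/negP => le; nra.
have c : 0 <= y * (1 - y ^+ 2) by rewrite mulr_ge0 //; lra.
(* The product below is [y^3 - 3/4 y + 1/4], so [y - y^3 <= (y + 1) / 4], and [y < 1]. *)
have d : y * (1 - y ^+ 2) <= 1 / 2.
  have : 0 <= (y - 1 / 2) ^+ 2 * (y + 1) by rewrite mulr_ge0 ?sqr_ge0 //; lra.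
  lra.
have : (y * (1 - y ^+ 2)) * (3 - y ^+ 2) <= 1 / 2 * 3.
  by apply: ler_pM => //; lra.
lra.
Qed.

(** Both roots are positive with squares above 3, and there the cofactor of [y - y'] in [F y - F y']
    is positive. *)
Lemma quintic_root_unique y y' : F y = 20 / 7 -> F y' = 20 / 7 -> y = y'.
Proof.
move=> Fy Fy'; have [y0 y3] := quintic_root_large Fy.
have [y'0 y'3] := quintic_root_large Fy'.
apply/eqP; rewrite -subr_eq0; apply/eqP.
have E : (y - y') * (y ^+ 4 + y ^+ 3 * y' + y ^+ 2 * y' ^+ 2 + y * y' ^+ 3 + y' ^+ 4
    - 4 * (y ^+ 2 + y * y' + y' ^+ 2) + 3) = 0.
  by transitivity (F y - F y'); [rewrite /F; ring | rewrite Fy Fy' subrr].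
have P : 0 < y * y' by apply: mulr_gt0.
suff : 0 < y ^+ 4 + y ^+ 3 * y' + y ^+ 2 * y' ^+ 2 + y * y' ^+ 3 + y' ^+ 4
    - 4 * (y ^+ 2 + y * y' + y' ^+ 2) + 3.
  by move=> pos; move/eqP: E; rewrite mulf_eq0 (gt_eqF pos) orbF => /eqP.
have e1 : 3 * y ^+ 2 <= y ^+ 4 by nra.
have e2 : 3 * y' ^+ 2 <= y' ^+ 4 by nra.
have e3 : 3 * (y * y') <= y ^+ 3 * y' by nra.
have e4 : 3 * (y * y') <= y * y' ^+ 3 by nra.
have e5 : 9 <= y ^+ 2 * y' ^+ 2 by nra.
nra.
Qed.

(** With [y = 2 cos a2], the lower bound will give [6 a2 < pi], so that the heptagon closes up. The
    upper bound is [2 cos a1] for the octagon, and makes the heptagon's circumradius the smaller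
    one. *)
Lemma quintic_root_exists : exists2 y, 9 / 5 < y < 48 / 25 & F y = 20 / 7.
Proof.
pose p : {poly R} := 'X^5 - 4%:R *: 'X^3 + 3%:R *: 'X - (20 / 7)%:P.
have pE y : p.[y] = F y - 20 / 7 by rewrite /p /F !hornerE.
have [||y yab /rootP] := @poly_ivt R p (9 / 5) (48 / 25).
- lra.
- by rewrite !pE /F; apply/andP; split; lra.
rewrite pE => /eqP; rewrite subr_eq0 => /eqP Fy; exists y => //.
move: yab => /andP[ya yb]; rewrite !lt_neqAle ya yb !andbT.
apply/andP; split; apply/eqP => E; move: Fy; rewrite /F.
  rewrite -E; lra.
rewrite E; lra.
Qed.

Lemma not_solvable_quintic y : F y = 20 / 7 -> ~ solvable_number (y%:C : R[i]).
Proof.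
move=> Fy sy; have [y0 _] := quintic_root_large Fy.
have yN0 : y != 0 by rewrite gt_eqF.
have rootE z : z != 0 -> root (map_poly intr quintic) z <-> F z^-1 = 20 / 7.
  move=> z0; rewrite /root horner_quintic /F; split=> [/eqP E|E].
    apply/eqP; rewrite -subr_eq0; apply/eqP.
    transitivity (- (20 * z ^+ 5 - 21 * z ^+ 4 + 28 * z ^+ 2 - 7)
      / (7 * z ^+ 5)); first by field.
    by rewrite E oppr0 mul0r.
  apply/eqP; transitivity (- (7 * z ^+ 5)
    * (z^-1 ^+ 5 - 4 * z^-1 ^+ 3 + 3 * z^-1 - 20 / 7)); first by field.
  by rewrite E subrr mulr0.
have mapE (z : R) :
    root (map_poly intr quintic) (z%:C : R[i]) = root (map_poly intr quintic) z.
  by rewrite -(fmorph_root (real_complex R)) map_intr_poly.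
apply: (@not_solvable_number _ Num.conj quintic (y^-1)%:C) => //.
- move=> n z n0 zn; have z0 : z != 0.
    apply/eqP => z0; move/eqP: zn.
    by rewrite z0 expr0n gtn_eqF // eq_sym oner_eq0.
  apply: (mulfI z0); rewrite divff // -sqr_norm.
  have -> : `|z| = 1; last by rewrite expr1n.
  by apply/eqP; rewrite -(@eqrXn2 _ n) // expr1n -normrX zn normr1.
- exact: irreducible_quintic.
- by rewrite quinticE.
- by rewrite quinticE.
- exact: conj_real.
- by rewrite mapE; apply/rootE; rewrite ?invr_neq0 // invrK.
- move=> z zR; have -> : z = (complex.Re z)%:C.
    move: zR; case: z => s t /eqP; rewrite eq_complex /= => /andP[_ /eqP t0].
    by apply/eqP; rewrite eq_complex /= eqxx; apply/eqP; lra.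
  move: (complex.Re z) => t {z zR}; rewrite mapE => qt; congr (_%:C).
  have t0 : t != 0.
    apply/eqP => t0; move: qt; rewrite t0 /root horner_quintic => /eqP.
    by rewrite !expr0n /=; lra.
  apply: (can_inj invrK); rewrite invrK; apply: quintic_root_unique => //.
  exact/rootE.
have -> : (y^-1)%:C = (y%:C)^-1 :> R[i] by rewrite fmorphV.
exact: SolvableInv.
Qed.
End RealRoot.

(** * The octagon and the heptagon *)

Section Angles.
Context {R : realType}.
Implicit Types x t : R.

Lemma cos_mulr3 x : cos (x *+ 3) = 4 * cos x ^+ 3 - 3 * cos x.
Proof.
have -> : x *+ 3 = x + x + x by ring.
rewrite !(sinD, cosD); have S := sin2cos2 x.
transitivity (cos x ^+ 3 - 3 * cos x * sin x ^+ 2); first by ring.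
by rewrite S; ring.
Qed.

Lemma sin_mulr3 x : sin (x *+ 3) = sin x * (4 * cos x ^+ 2 - 1).
Proof.
have -> : x *+ 3 = x + x + x by ring.
rewrite !(sinD, cosD); have S := sin2cos2 x.
transitivity (sin x * (3 * cos x ^+ 2 - sin x ^+ 2)); first by ring.
by rewrite S; ring.
Qed.

Lemma sin_mulr6 x (y := 2 * cos x) :
  sin (x *+ 6) = sin x * (y ^+ 5 - 4 * y ^+ 3 + 3 * y).
Proof.
have -> : x *+ 6 = (x *+ 3) *+ 2 by rewrite -mulrnA.
by rewrite sin_mulr2n cos_mulr3 sin_mulr3 /y; ring.
Qed.

Lemma cos_mulr6 x : cos (x *+ 6) = 2 * (4 * cos x ^+ 3 - 3 * cos x) ^+ 2 - 1.
Proof.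
have -> : x *+ 6 = (x *+ 3) *+ 2 by rewrite -mulrnA.
by rewrite cos_mulr2n cos_mulr3; ring.
Qed.

Lemma acos_acute t : 0 < t < 1 ->
  [/\ cos (acos t) = t, 0 < acos t, acos t < pi / 2 & 0 < sin (acos t)].
Proof.
move=> /andP[t0 t1].
have tI : t \in `[-1, 1] by rewrite in_itv /=; apply/andP; split; lra.
have cE : cos (acos t) = t by apply: acosK.
have a0 : 0 < acos t by apply: acos_gt0; apply/andP; split; lra.
have api : acos t <= pi by apply: acos_lepi; apply/andP; split; lra.
have pi0 := pi_gt0 R.
have a2 : acos t < pi / 2.
  rewrite -ltr_cos ?in_itv /=; last 2 first.
  - by apply/andP; split; lra.
  - by apply/andP; split; lra.
  by rewrite cos_pihalf cE.
by split=> //; apply: sin_gt0_pi; apply/andP; split; lra.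
Qed.

(** The cubic [4 c^3 - 3 c] is positive for [c >= 9/10], so [cos (3 x) > 0], whereas [6 x >= pi]
    would put [3 x] between [pi/2] and [3 pi/2]. *)
Lemma mulr6_lt_pi x : 0 < x -> x < pi / 2 -> 9 / 10 <= cos x -> x *+ 6 < pi.
Proof.
move=> x0 x2 c; have pi0 := pi_gt0 R.
rewrite ltNge; apply/negP => le.
have : 0 <= cos (x *+ 3 - pi) by apply: cos_ge0_pihalf; apply/andP; split; lra.
rewrite cosB cospi sinpi cos_mulr3; nra.
Qed.

Lemma sin_pythagorean t s : 0 < t < 1 -> 0 < s -> t ^+ 2 + s ^+ 2 = 1 ->
  sin (acos t) = s.
Proof.
move=> t01 s0 E; have [cE _ _ sin0] := acos_acute t01.
apply/eqP; rewrite -(@eqrXn2 _ 2) ?ltW // sin2cos2 cE; apply/eqP; lra.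
Qed.
End Angles.

Lemma cross_shift (R : realType) (p q s : R[i]) :
  cross (q - p) (s - q) = cross (q - p) (s - p).
Proof. by case: p q s => a b [c d] [e f]; rewrite /cross /=; ring. Qed.

Lemma constr_corner (R : realType) (p q s : R[i]) :
  constr (Line (line p q)) -> constr (Line (line q s)) ->
  0 < cross (q - p) (s - p) -> constr (Point q).
Proof.
have Eq : q = p + (q - p) by rewrite addrC subrK.
have Es : s = q + (s - q) by rewrite addrC subrK.
rewrite {1}Eq {1}Es => cl cm pos; apply: (constr_meet cl cm).
- by rewrite cross_shift gt_eqF.
- by exists 1; rewrite (_ : 1%:C = 1) //; ring.
- by exists 0; rewrite (_ : 0%:C = 0) //; ring.
Qed.

Section Octagon.
Context {R : realType}.
Local Notation C := R[i].

(* Half central angles with rational sines 7/25 and 4/5 (ratio 20/7) and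
   rational cosines. *)
Let a1 : R := acos (24 / 25).
Let b1 : R := acos (3 / 5).

Let a1_bounds : [/\ cos a1 = 24 / 25, 0 < a1, a1 < pi / 2 & 0 < sin a1].
Proof. by apply: acos_acute; apply/andP; split; lra. Qed.

Let b1_bounds : [/\ cos b1 = 3 / 5, 0 < b1, b1 < pi / 2 & 0 < sin b1].
Proof. by apply: acos_acute; apply/andP; split; lra. Qed.

Let sin_a1 : sin a1 = 7 / 25.
Proof. by apply: sin_pythagorean; [apply/andP; split| |]; lra. Qed.

Let sin_b1 : sin b1 = 4 / 5.
Proof. by apply: sin_pythagorean; [apply/andP; split| |]; lra. Qed.

(** The half angle left for the eighth side is [pi - 6 a1 - b1]. It must be positive for the octagon
    to close up, and below [pi/2] for it to be central. *)
Let angle_sum : a1 *+ 6 + b1 < pi /\ pi / 2 < a1 *+ 6 + b1.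
Proof.
have pi0 := pi_gt0 R.
have [ca a0 a2 _] := a1_bounds; have [cb b0 b2 _] := b1_bounds.
have a6 : a1 *+ 6 < pi by apply: mulr6_lt_pi => //; rewrite ca; lra.
have c6 := cos_mulr6 a1; rewrite ca in c6.
split.
  rewrite -ltrBrDr -ltr_cos ?in_itv /=; [|by apply/andP; split; lra..].
  by rewrite cosB cospi sinpi cb c6; lra.
rewrite -ltrBlDr -ltr_cos ?in_itv /=; [|by apply/andP; split; lra..].
by rewrite cosB cos_pihalf sin_pihalf sin_b1 c6; lra.
Qed.

Let phi1 (j : nat) : R :=
  if (j <= 6)%N then a1 *+ 2 *+ j
  else if j == 7%N then a1 *+ 2 *+ 6 + b1 *+ 2 else pi *+ 2.

Let P1 : seq C := mkseq (fun j => cis (phi1 j)) 8.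

(** Chords of the unit circle: [14/25 = 2 sin a1] six times, [8/5 = 2 sin b1], which is 20/7 times
    as long, and the chord of the remaining arc. *)
Definition octagon_sides : seq R :=
  [:: 14 / 25; 14 / 25; 14 / 25; 14 / 25; 14 / 25; 14 / 25; 8 / 5;
      2 * sin (pi - a1 *+ 6 - b1)].

Let phi1_gap i : (i < 8)%N -> 0 < phi1 i.+1 - phi1 i < pi.
Proof.
have [_ a0 a2 _] := a1_bounds; have [_ b0 b2 _] := b1_bounds.
have [s1 s2] := angle_sum; have pi0 := pi_gt0 R.
by case: i => [|[|[|[|[|[|[|[|i]]]]]]]] //= _; rewrite /phi1 /=; apply/andP; split; lra.
Qed.

Let phi1_half i : (i < 6)%N -> (phi1 i.+1 - phi1 i) / 2 = a1.
Proof. by case: i => [|[|[|[|[|[|i]]]]]] //= _; rewrite /phi1 /=; lra. Qed.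

Let phi1_end : phi1 8 = phi1 0 + pi *+ 2.
Proof. by rewrite /phi1 /= mulr0n add0r. Qed.

Let norm1C : `|1 : C| = (1 : R)%:C. Proof. by rewrite normr1. Qed.

Let P1E j : (j < 8)%N -> P1`_j = 0 + 1 * cis (phi1 j).
Proof. by move=> j8; rewrite nth_mkseq // mul1r add0r. Qed.

Lemma octagon_Cy : Cy octagon_sides P1`_0 P1`_1 P1 0 1.
Proof.
apply: (@cyclic_Cy R 8 phi1 P1 0 1 1) => //.
- by move=> j /phi1_gap /andP[]; rewrite subr_gt0.
case=> [|[|[|[|[|[|[|[|i]]]]]]]] //= _; rewrite mulr1;
  try by rewrite phi1_half // sin_a1; lra.
- have -> : (phi1 7 - phi1 6) / 2 = b1 by rewrite /phi1 /=; lra.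
  by rewrite sin_b1; lra.
by congr (_ * sin _); rewrite /phi1 /=; lra.
Qed.

Lemma octagon_central : interior_ccw P1 0.
Proof.
apply: (@cyclic_central R 8 phi1 P1 0 1 1) => //.
- by move=> j /phi1_gap /andP[]; rewrite subr_gt0.
by move=> j /phi1_gap /andP[].
Qed.

Lemma constr_octagon z : z \in P1 -> constr (Point z).
Proof.
have frac (m n : nat) : constr_real (m%:R / n%:R : R).
  by apply: constr_realM; [|apply: constr_realV]; apply: constr_real_nat.
have [ca _ _ _] := a1_bounds; have [cb _ _ _] := b1_bounds.
have cis_rat (x : R) : constr_real (cos x) -> constr_real (sin x) ->
    constr (Point (cis x)) by apply: constr_complex.
have cisXn (x : R) n : constr (Point (cis x)) -> constr (Point (cis (x *+ n))).
  move=> cx; elim: n => [|n IHn]; first by rewrite mulr0n cis0; apply: constr1.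
  by rewrite mulrS cisD; apply: constr_pointM.
have za : constr (Point (cis a1)) by apply: cis_rat; rewrite ?ca ?sin_a1.
have zb : constr (Point (cis b1)) by apply: cis_rat; rewrite ?cb ?sin_b1.
case/mapP => j; rewrite mem_iota add0n => /andP[_ j8] ->.
rewrite /phi1; case: ifP => j6; first by apply: (cisXn); apply: (cisXn).
have -> : j == 7%N by rewrite eqn_leq -ltnS j8 ltnNge j6.
by rewrite cisD; apply: constr_pointM; do ?apply: (cisXn).
Qed.

(** * The heptagon cut off from the octagon *)

Section Heptagon.
Variable y : R.
Hypothesis y_bounds : 9 / 5 < y < 48 / 25.
Hypothesis y_root : y ^+ 5 - 4 * y ^+ 3 + 3 * y = 20 / 7.

Let a2 : R := acos (y / 2).

Let a2_bounds : [/\ cos a2 = y / 2, 0 < a2, a2 < pi / 2 & 0 < sin a2].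
Proof.
by have /andP[? ?] := y_bounds; apply: acos_acute; apply/andP; split; lra.
Qed.

Let a2_lt : a2 *+ 6 < pi.
Proof.
have [ca a0 a2' _] := a2_bounds; have /andP[? ?] := y_bounds.
by apply: mulr6_lt_pi => //; rewrite ca; lra.
Qed.

Let sin_a2_6 : sin (a2 *+ 6) = 20 / 7 * sin a2.
Proof.
have [ca _ _ _] := a2_bounds.
have -> : 20 / 7 = y ^+ 5 - 4 * y ^+ 3 + 3 * y by rewrite y_root.
by rewrite sin_mulr6 ca mulrC; congr (_ * _); field.
Qed.

Let sin_a1_a2 : sin a1 < sin a2.
Proof.
have [ca1 a0 a2' sa1] := a1_bounds; have [ca b0 b2 sa] := a2_bounds.
have /andP[y1 y2] := y_bounds.
have e1 := sin2cos2 a1; have e2 := sin2cos2 a2; rewrite ca1 in e1; rewrite ca in e2.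
rewrite ltNge; apply/negP => le.
have : sin a2 * sin a2 <= sin a1 * sin a1 by apply: ler_pM => //; apply: ltW.
have : y * y < 48 / 25 * (48 / 25) by apply: ltr_pM; lra.
lra.
Qed.

Let phi2 (j : nat) : R := if (j <= 6)%N then a2 *+ 2 *+ j else pi *+ 2.

(** [w2] and [c2] are solved from the requirement that the vertices at angles 0 and [2 a2] be the
    first two of the octagon. *)
Let w2 : C := (P1`_1 - P1`_0) / (cis (a2 *+ 2) - 1).
Let c2 : C := P1`_0 - w2.
Let r2 : R := complex.Re `|w2|.

Definition heptagon : seq C := mkseq (fun j => c2 + w2 * cis (phi2 j)) 7.

Let cis_a2_neq1 : cis (a2 *+ 2) - 1 != 0 :> C.
Proof.
have [ca a0 a2' sa] := a2_bounds.
rewrite subr_eq0 eq_complex negb_and; apply/orP; right.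
rewrite /= sin_mulr2n mulrn_eq0 /= mulf_eq0 negb_or (gt_eqF sa) ca andbT.
by have /andP[y1 y2] := y_bounds; rewrite gt_eqF //; lra.
Qed.

Let chord : `|P1`_1 - P1`_0| = (14 / 25)%:C.
Proof.
by have [_ [_ /(_ 0 isT)]] := octagon_Cy.
Qed.

Let P1_0 : P1`_0 = 1 :> C.
Proof. by rewrite /P1 nth_mkseq // /phi1 /= mulr0n cis0. Qed.

Let w2_neq0 : w2 != 0.
Proof.
rewrite mulf_neq0 ?invr_neq0 // -normr_gt0 chord ltcR; lra.
Qed.

Let r2_gt0 : 0 < r2.
Proof. by rewrite -ltcR -[r2%:C]/`|w2| normr_gt0. Qed.

Let heptagon0 : heptagon`_0 = P1`_0.
Proof. by rewrite nth_mkseq // /phi2 /= mulr0n cis0 mulr1 /c2 subrK. Qed.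

Let heptagon1 : heptagon`_1 = P1`_1.
Proof.
rewrite nth_mkseq // /phi2 /= mulr1n /c2.
have -> : P1`_0 - w2 + w2 * cis (a2 *+ 2) = P1`_0 + w2 * (cis (a2 *+ 2) - 1) by ring.
by rewrite /w2 divfK // addrC subrK.
Qed.

Let heptE j : (j < 7)%N -> heptagon`_j = c2 + w2 * cis (phi2 j).
Proof. by move=> j7; rewrite nth_mkseq. Qed.

Let r2_sin : 2 * r2 * sin a2 = 14 / 25.
Proof.
have [ca a0 a2' sa] := a2_bounds.
apply: complexI; rewrite -chord -heptagon1 -heptagon0 !heptE // (@norm_chord R c2 w2 r2) //.
- by congr (_ * sin _)%:C; rewrite /phi2 /=; lra.
- exact: ltW.
by have pi0 := pi_gt0 R; rewrite /phi2 /=; apply/andP; split; lra.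
Qed.

Let phi2_gap i : (i < 7)%N -> phi2 i < phi2 i.+1.
Proof.
have [_ a0 a2' _] := a2_bounds; have lt := a2_lt.
by case: i => [|[|[|[|[|[|[|i]]]]]]] //= _; rewrite /phi2 /=; lra.
Qed.

Let phi2_half i : (i < 6)%N -> (phi2 i.+1 - phi2 i) / 2 = a2.
Proof. by case: i => [|[|[|[|[|[|i]]]]]] //= _; rewrite /phi2 /=; lra. Qed.

Let phi2_end : phi2 7 = phi2 0 + pi *+ 2.
Proof. by rewrite /phi2 /= mulr0n add0r. Qed.

Lemma heptagon_Cy : Cy (take 7 octagon_sides) P1`_0 P1`_1 heptagon c2 r2.
Proof.
rewrite -heptagon0 -heptagon1.
apply: (@cyclic_Cy R 7 phi2 heptagon c2 w2 r2) => //.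
case=> [|[|[|[|[|[|[|i]]]]]]] //= _; try by rewrite phi2_half // r2_sin.
(* The quintic enters here: the last half angle has sine [sin (6 a2) = 20/7 sin a2], so the seventh
   side is [20/7 * 14/25 = 8/5]. *)
have -> : (phi2 7 - phi2 6) / 2 = pi - a2 *+ 6 by rewrite /phi2 /=; lra.
rewrite sinB sinpi cospi mul0r sub0r mulN1r opprK sin_a2_6.
have -> : 2 * r2 * (20 / 7 * sin a2) = 20 / 7 * (2 * r2 * sin a2) by ring.
by rewrite r2_sin; lra.
Qed.

Lemma constr_heptagon_side j : (j < 7)%N -> constr (Line (side_line heptagon j)).
Proof.
move=> j7; apply: (constr_axiom (covered_points constr_octagon)).
right; exists 7%N, 1%N; split=> //; first by left.
apply: (@CPA_fold _ 7 1 _ octagon_sides P1 heptagon 0 1 c2 r2 j) => //.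
- by move=> z zP; exists z.
- exact: octagon_Cy.
- exact: octagon_central.
- exact: heptagon_Cy.
(* The equal sides satisfy [r2 sin a2 = 7/25 = sin a1], and [sin a1 < sin a2], whence [r2 < 1]. *)
- have r := r2_sin; have lt := sin_a1_a2; rewrite sin_a1 in lt.
  rewrite ltNge; apply/negP => le; nra.
apply: (@polygon_ineq_bound _ _ (8 / 5)); first by lra.
  by move=> x; rewrite !inE; do !case/orP => [/eqP ->|]; try lra; move/eqP => ->; lra.
by rewrite !big_cons big_nil; lra.
Qed.

(** This is the first vertex not shared with the octagon. Two consecutive folded sides meet there;
    convexity ensures that they are not parallel. *)
Lemma constr_heptagon2 : constr (Point heptagon`_2).
Proof.
have s1 := constr_heptagon_side (isT : (1 < 7)%N).
have s2 := constr_heptagon_side (isT : (2 < 7)%N).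
have [_ _ _ cvx _] := heptagon_Cy.
have := cvx 1%N 3%N isT isT isT isT.
exact: constr_corner s1 s2.
Qed.

(** The first two sides have equal length and differ by the rotation [cis (2 a2)]. A solvable vertex
    would make this rotation solvable, then its square root [cis a2], and finally [y = 2 cos a2]. *)
Lemma not_solvable_heptagon2 : ~ solvable_number heptagon`_2.
Proof.
have [ca a0 a2' sa] := a2_bounds.
move=> sB; apply: (not_solvable_quintic y_root).
have snat n : solvable_number (n%:R : C).
  elim: n => [|n IHn]; first exact: solv0.
  by rewrite -natr1; apply: solvD => //; apply: solv1.
(* [cis t] is a root of [z^2 - 2 cos t z + 1]. *)
have s_cis t : solvable_number ((cos t)%:C : C) -> solvable_number (cis t : C).
  move=> sc; apply: (solv_root2 (b := 1) (c := - (2%:R * (cos t)%:C)) (d := 1)).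
  - exact: solv1.
  - by apply: solvN; apply: SolvableMul.
  - exact: solv1.
  - by rewrite oner_neq0.
  apply/eqP; rewrite eq_complex /=; have := cos2Dsin2 t => E.
  by apply/andP; split; apply/eqP; lra.
have sA : solvable_number P1`_1.
  rewrite /P1 nth_mkseq // /phi1 /= mulr1n cisX; apply: solvX.
  apply: s_cis; have [-> _ _ _] := a1_bounds.
  by rewrite fmorph_div !rmorph_nat; apply: solv_div.
have E2 : heptagon`_2 - P1`_1 = cis (a2 *+ 2) * (P1`_1 - 1).
  rewrite -heptagon1 -P1_0 -heptagon0 !heptE // /phi2 /= mulr1n mulr0n cis0.
  by rewrite [cis (a2 *+ 2 *+ 2)]cisX; ring.
have A1 : P1`_1 - 1 != 0.
  by rewrite -P1_0 -normr_gt0 chord ltcR; lra.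
have sz : solvable_number (cis (a2 *+ 2) : C).
  have -> : cis (a2 *+ 2) = (heptagon`_2 - P1`_1) / (P1`_1 - 1) by rewrite E2 mulfK.
  by apply: solv_div; apply: SolvableSub => //; apply: solv1.
have sc : solvable_number (cis a2 : C).
  apply: (solv_root2 (b := 1) (c := 0) (d := - cis (a2 *+ 2))).
  - exact: solv1.
  - exact: solv0.
  - exact: solvN.
  - by rewrite oner_neq0.
  by rewrite cisX mul1r mul0r addr0 subrr.
have -> : y%:C = cis a2 + (cis a2)^*.
  rewrite cisC; apply/eqP; rewrite eq_complex /= cosN sinN subrr eqxx andbT ca.
  by apply/eqP; lra.
by apply: solvD => //; apply: solv_conj.
Qed.
End Heptagon.
End Octagon.

Theorem theorem5p6 (R : realType) : O_RP R `<` O_CP R.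
Proof.
split; first exact: O_RP_sub_O_CP.
have [y y_bounds y_root] := quintic_root_exists R.
move=> sub; apply: (not_solvable_heptagon2 y_bounds y_root).
by apply: O_RP_solvable; apply: sub; apply: constr_heptagon2.
Qed.
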